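(* Let $(T,\le)$ be a countable (reversed) well-founded tree. Then $\le$ has a downward-finite extension which is a well-order of order type $\sigma(T,\le)$. Moreover, every well-order on $T$ which is a downward-finite extension of $\le$ has order type at most $\sigma(T,\le)$.
   Context: A (reversed) well-founded tree is a well-founded partially ordered set $(T,\le)$ such that for every $t\in T$ the set $\{s\in T\mid s>t\}$ is finite and linearly ordered. For $t\in T$, $P(t)$ denotes the set of immediate predecessors of $t$, and $M$ the set of maximal elements of $T$. For a family of ordinals $(\alpha_i)_{i\in I}$ indexed by a set $I$, define $\bigoplus_{i\in I}\alpha_i=\inf_{\zeta,f}\bigoplus_{\gamma<\zeta}\alpha_{f(\gamma)}$, where $\zeta$ ranges over ordinals of cardinality $|I|$ and $f$ over bijections $\zeta\to I$; here $\oplus$ is the Hessenberg natural sum (add Cantor normal forms coefficientwise over a common list of exponents) and $\bigoplus_{\gamma<\zeta}$ is the iterated natural sum defined by recursion: $0$ at $0$, $(\bigoplus_{\gamma<\delta}\alpha_\gamma)\oplus\alpha_\delta$ at $\delta+1$, supremum at limits. The size of $t\in T$ is defined by recursion on rank: $\sigma(t)=\big(\bigoplus_{u\in P(t)}\sigma(u)\big)+1$ (ordinal $+$), and $\sigma(T,\le)=\bigoplus_{t\in M}\sigma(t)$. For $t\in T$ let ${\downarrow}t=\{u\in T\mid u\le t\}$, and for another order $\le'$ on $T$ let ${\downarrow}'t=\{u\in T\mid u\le' t\}$. An order $\le'$ on $T$ is a downward-finite extension of $\le$ if $u\le t$ implies $u\le' t$, and for every $v\in T$ there are finitely many elements $u_0,\dots,u_n$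 of $T$, each $\le$-incomparable with $v$, such that ${\downarrow}'v\subseteq{\downarrow}v\cup{\downarrow}u_0\cup\dots\cup{\downarrow}u_n$. *)

(* Defs.v *)
From Corelib Require Import Relation_Definitions.
From mathcomp Require Import all_boot.
From mathcomp Require Import boolp classical_sets cardinality.

Set Implicit Arguments.
Unset Strict Implicit.
Unset Printing Implicit Defensive.

Local Open Scope classical_set_scope.

Definition strict (T : Type) (le : relation T) : relation T :=
  fun x y => le x y /\ x <> y.

(* [Relation_Definitions.order] is reflexivity, transitivity, antisymmetry. *)
Record is_well_order (T : Type) (le : relation T) : Prop := IsWellOrder {
  wo_order : Relation_Definitions.order T le;
  wo_total : forall x y, le x y \/ le y x;
  wo_wf : well_founded (strict le) }.

Record wellOrder := WellOrder {
  wo_sort :> Type;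
  wo_le : relation wo_sort;
  wo_axiom : is_well_order wo_le }.

Definition wo_iso (V W : wellOrder) : Prop :=
  exists2 f : V -> W, bijective f &
    forall x y, wo_le x y <-> wo_le (f x) (f y).

(* The proper initial segment of W below x. *)
Definition seg_le (W : wellOrder) (x : W) :
    relation {y : W | strict (@wo_le W) y x} :=
  fun y z => wo_le (sval y) (sval z).

Lemma seg_axiom (W : wellOrder) (x : W) : is_well_order (@seg_le W x).
Proof.
case: (wo_axiom W) => -[r t a] tot wf; split.
- split.
  + by move=> y; exact: r.
  + by move=> y z u; exact: t.
  + by move=> [y hy] [z hz] h1 h2; apply: eq_exist; exact: a.
- by move=> y z; exact: tot.
- suff H y : Acc (strict (@wo_le W)) y ->
      forall h, Acc (strict (@seg_le W x)) (exist _ y h).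
    by move=> [y hy]; exact/H/wf.
  elim=> {}y _ IH h; constructor=> -[z hz] [/= h1 h2]; apply: IH; split=> //.
  by move=> e; apply: h2; exact: eq_exist.
Qed.

Definition seg (W : wellOrder) (x : W) : wellOrder :=
  WellOrder (@seg_axiom W x).

(* Ordinals are isomorphism classes of well-orders. *)
Definition ordinal_num : Type :=
  {C : set wellOrder | exists W, C = [set V | wo_iso W V]}.

Definition otype (W : wellOrder) : ordinal_num :=
  exist _ [set V | wo_iso W V] (ex_intro _ W erefl).

Definition olt (a b : ordinal_num) : Prop :=
  exists (W : wellOrder) (x : W), b = otype W /\ a = otype (seg x).

Definition ole (a b : ordinal_num) : Prop := olt a b \/ a = b.

Lemma wo_iso_refl W : wo_iso W W.
Proof. by exists id => //; exists id. Qed.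

Lemma otype_iso V W : otype V = otype W -> wo_iso V W.
Proof.
move=> /(congr1 (@sval _ _)) /= e.
have : [set U | wo_iso W U] W by exact: wo_iso_refl.
by rewrite -e.
Qed.

Lemma wo_iso_sym V W : wo_iso V W -> wo_iso W V.
Proof.
move=> [f [g fK gK] h]; exists g; first by exists f.
by move=> x y; rewrite -{1}(gK x) -{1}(gK y); split=> /h.
Qed.

Lemma wo_iso_trans U V W : wo_iso U V -> wo_iso V W -> wo_iso U W.
Proof.
move=> [f bf h] [g bg k]; exists (g \o f); first exact: bij_comp.
by move=> x y; split=> [/h/k|/k/h].
Qed.

Lemma iso_otype V W : wo_iso V W -> otype V = otype W.
Proof.
move=> VW; have e : [set U | wo_iso V U] = [set U | wo_iso W U].
  apply/seteqP; split=> U /=; last exact: wo_iso_trans.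
  by apply: wo_iso_trans; exact: wo_iso_sym.
rewrite /otype; move: (ex_intro _ _ _) (ex_intro _ _ _); rewrite e => p q.
by congr exist; exact: Prop_irrelevance.
Qed.

Lemma iso_seg (V W : wellOrder) (f : V -> W) (x : V) : bijective f ->
  (forall x y, wo_le x y <-> wo_le (f x) (f y)) -> wo_iso (seg x) (seg (f x)).
Proof.
move=> [g fK gK] h.
have F (y : seg x) : strict (@wo_le W) (f (sval y)) (f x).
  by case: y => y [h1 h2]; split; [exact/h | move/(can_inj fK)].
have G (z : seg (f x)) : strict (@wo_le V) (g (sval z)) x.
  case: z => z [h1 h2]; split=> /=; first by apply/h; rewrite gK.
  by move=> e; apply: h2; rewrite -e gK.
exists (fun y => exist (fun z => strict (@wo_le W) z (f x)) _ (F y)).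
  exists (fun z => exist (fun y => strict (@wo_le V) y x) _ (G z)).
  - by move=> [y hy]; apply: eq_exist; rewrite /= fK.
  - by move=> [z hz]; apply: eq_exist; rewrite /= gK.
by move=> [y hy] [z hz]; exact: h.
Qed.

Lemma iso_seg_seg (W : wellOrder) (x : W) (y : seg x) :
  wo_iso (seg y) (seg (sval y)).
Proof.
case: y => y hy.
have wt (a : W) : strict (@wo_le W) a y -> strict (@wo_le W) a x.
  case: (wo_order (wo_axiom W)) hy => r t ant [h1 h2] [h3 h4].
  split; first exact: t h3 h1.
  by move=> e; subst a; apply: h2; exact: ant.
have F (z : seg (exist _ y hy : seg x)) : strict (@wo_le W) (sval (sval z)) y.
  case: z => -[z hz] [h1 h2]; split=> //= e; apply: h2.
  exact: eq_exist.
pose P z := strict (@wo_le W) z x.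
have G (z : seg y) :
    strict (@wo_le (seg x)) (exist P (sval z) (wt _ (svalP z))) (exist P y hy).
  by case: z => z [h1 h2]; split=> // -[].
exists (fun z => exist (fun z => strict (@wo_le W) z y) _ (F z)).
  exists (fun z => exist (fun z => strict (@wo_le (seg x)) z (exist P y hy)) _ (G z)).
  - by move=> [[z hz] hz']; apply: eq_exist; exact: eq_exist.
  - by move=> [z hz]; exact: eq_exist.
by move=> [[a ha] ?] [[b hb] ?].
Qed.

Lemma olt_wf : well_founded olt.
Proof.
have A (W : wellOrder) (x : W) : Acc olt (otype (seg x)).
  elim/(well_founded_ind (wo_wf (wo_axiom W))): x => x IH.
  constructor=> c [V [y [/otype_iso/wo_iso_sym[f bf h] ->]]].
  rewrite (iso_otype (iso_seg y bf h)) (iso_otype (iso_seg_seg (f y))).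
  by apply: IH; case: (f y).
move=> b; constructor=> a [W [x [_ ->]]]; exact: A.
Qed.

Lemma void_axiom : is_well_order (fun _ _ : void => True).
Proof. by split; [split|..]; case. Qed.

Definition ozero : ordinal_num := otype (WellOrder void_axiom).

(* The infimum (least element) of a nonempty class of ordinals; the value is
   junk on the empty class. *)
Definition oinf (A : set ordinal_num) : ordinal_num :=
  if pselect (exists a, A a /\ forall b, A b -> ole a b) is left h
  then sval (cid h) else ozero.

(* Junk on classes that are not bounded above. *)
Definition osup (A : set ordinal_num) : ordinal_num :=
  oinf [set b | forall a, A a -> ole a b].

Definition osucc (a : ordinal_num) : ordinal_num := oinf [set b | olt a b].

Definition below (d : ordinal_num) : Type := {c : ordinal_num | olt c d}.

(* The function F on ordinals such that F 0 = z, F (c + 1) = s c (F c), and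
   F d is the supremum of the F c, c < d, for d limit. *)
Definition orec (z : ordinal_num) (s : ordinal_num -> ordinal_num -> ordinal_num) :
    ordinal_num -> ordinal_num :=
  Fix olt_wf (fun _ => ordinal_num) (fun d F =>
    if pselect (d = ozero) then z
    else if pselect (exists c : below d, d = osucc (sval c)) is left h
    then let c := sval (cid h) in s (sval c) (F (sval c) (svalP c))
    else osup [set F (sval c) (svalP c) | c in [set: below d]]).

Definition oadd (a b : ordinal_num) : ordinal_num :=
  orec a (fun _ r => osucc r) b.

Definition omul (a b : ordinal_num) : ordinal_num :=
  orec ozero (fun _ r => oadd r a) b.

Definition oexp (a b : ordinal_num) : ordinal_num :=
  orec (osucc ozero) (fun _ r => omul r a) b.

Definition onat (n : nat) : ordinal_num := iter n osucc ozero.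

Definition omega : ordinal_num := osup (range onat).

(* omega^e_1 c(e_1) + ... + omega^e_k c(e_k) for e = [:: e_1; ...; e_k]. *)
Definition cnf (e : seq ordinal_num) (c : ordinal_num -> nat) : ordinal_num :=
  foldr (fun x r => oadd (omul (oexp omega x) (onat (c x))) r) ozero e.

(* Null coefficients are allowed, so that any two ordinals have Cantor normal
   forms over a common list of exponents. *)
Definition is_natural_sum (a b r : ordinal_num) : Prop :=
  exists (e : seq ordinal_num) (p q : ordinal_num -> nat),
    [/\ sorted (fun x y => `[< olt y x >]) e,
        a = cnf e p, b = cnf e q & r = cnf e (fun x => p x + q x)].

(* The sum is unique, so that [oinf] merely selects it. *)
Definition natural_sum (a b : ordinal_num) : ordinal_num :=
  oinf [set r | is_natural_sum a b r].

(* The iterated natural sum of a d-sequence; the value taken by the recursion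
   step outside of d is irrelevant. *)
Definition iter_natural_sum (d : ordinal_num) (a : below d -> ordinal_num) :
    ordinal_num :=
  orec ozero (fun c r =>
    natural_sum r (if pselect (olt c d) is left h then a (exist _ c h)
                   else ozero)) d.

Definition big_natural_sum (I : Type) (a : I -> ordinal_num) : ordinal_num :=
  oinf [set r | exists (d : ordinal_num) (f : below d -> I),
                  bijective f /\ r = iter_natural_sum (fun c => a (f c))].

Record is_wf_tree (T : Type) (le : relation T) : Prop := IsWfTree {
  tree_order : Relation_Definitions.order T le;
  tree_wf : well_founded (strict le);
  tree_up_finite : forall t, finite_set [set s | strict le t s];
  tree_up_linear : forall t s u,
    strict le t s -> strict le t u -> le s u \/ le u s }.

Definition immediate_pred (T : Type) (le : relation T) (t : T) : set T :=
  [set u | strict le u t /\ ~ exists s, strict le u s /\ strict le s t].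

Definition maximal (T : Type) (le : relation T) : set T :=
  [set t | ~ exists s, strict le t s].

Definition node_size (T : Type) (le : relation T) (tree : is_wf_tree le) :
    T -> ordinal_num :=
  Fix (tree_wf tree) (fun _ => ordinal_num) (fun t size =>
    oadd (big_natural_sum (fun u : {u : T | immediate_pred le t u} =>
            size (sval u) (svalP u).1))
         (osucc ozero)).

Definition tree_size (T : Type) (le : relation T) (tree : is_wf_tree le) :
    ordinal_num :=
  big_natural_sum (fun t : {t : T | maximal le t} => node_size tree (sval t)).

Definition down (T : Type) (le : relation T) (t : T) : set T :=
  [set u | le u t].

Definition incomparable (T : Type) (le : relation T) (u v : T) : Prop :=
  ~ le u v /\ ~ le v u.

(* The finite set A of incomparable elements may be empty (for instance, it must
   be so when v is the greatest element of T). *)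
Definition downward_finite_extension (T : Type) (le le' : relation T) : Prop :=
  [/\ Relation_Definitions.order T le',
      forall u t, le u t -> le' u t &
      forall v, exists A : set T,
        [/\ finite_set A,
            forall u, A u -> incomparable le u v &
            down le' v `<=` down le v `|` \bigcup_(u in A) down le u]].

(* Main.v *)
(* Every labelling argument is carried out inside the ordinals: a well-order has
   type [a] as soon as it maps increasingly onto the ordinals below [a].

   Upper bound.  If a well-ordered set is covered by two pieces of types at most
   [a] and [b], then ranking a point by the natural sum of the types of the parts
   of the two pieces below it is increasing, so the whole has type at most the
   natural sum of [a] and [b].  Downward finiteness covers each initial segment
   of the trees below the children of a node by finitely many of these trees, so
   the segment, hence the union, is bounded by every iterated natural sum of the
   sizes of the children.

   Existence.  Cantor normal forms interleave [a] and [b] into their natural sum,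
   hence finitely many sizes into their sum.  For a sequence of nonzero sizes
   [s n], let [l] be least with [s n < omega^l] for [n >= N]: interleave the first
   [N] terms and append the others one after the other.  Both this and the
   iterated natural sum give the sum of the first [N] terms plus [omega^l], and
   only finitely many terms start below any given point.  The upper bound shows
   that no other enumeration of the sizes gives a smaller sum. *)

From HB Require Import structures.
Require Import Defs.
From Corelib Require Import Relation_Definitions.
From mathcomp Require Import all_boot all_order.
From mathcomp Require Import boolp classical_sets cardinality.

Set Implicit Arguments.
Unset Strict Implicit.
Unset Printing Implicit Defensive.

Import Order.TTheory.

Local Open Scope order_scope.
Local Open Scope classical_set_scope.

(** * Ordinals as a total order *)

Definition rk (W : wellOrder) (x : W) : ordinal_num := otype (seg x).

Lemma olt_otype (W : wellOrder) c :
  olt c (otype W) <-> exists x : W, c = rk x.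
Proof.
split=> [[V [x [e ->]]]|[x ->]]; last by exists W, x.
have /wo_iso_sym[f bf h] := otype_iso e.
by exists (f x); exact: iso_otype (iso_seg x bf h).
Qed.

Lemma olt_rk (W : wellOrder) (x : W) c :
  olt c (rk x) <-> exists2 y, strict (@wo_le W) y x & c = rk y.
Proof.
rewrite /rk olt_otype; split=> [[y ->]|[y yx ->]].
  by exists (sval y); [exact: (svalP y)|exact/iso_otype/iso_seg_seg].
pose z : seg x := exist _ y yx.
by exists z; rewrite /rk (iso_otype (iso_seg_seg z)).
Qed.

Lemma otype_surj (a : ordinal_num) : exists W, a = otype W.
Proof. by case: a => C h; have [W e] := h; exists W; exact: eq_exist. Qed.

Lemma olt_irr a : ~ olt a a.
Proof. by elim/(well_founded_ind olt_wf): a => a IH aa; exact: (IH _ aa aa). Qed.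

Lemma olt_trans b a c : olt a b -> olt b c -> olt a c.
Proof.
have [W ->] := otype_surj c; move=> ab /olt_otype[x e].
by move: ab; rewrite {}e => /olt_rk[y _ ->]; apply/olt_otype; exists y.
Qed.

Lemma rk_mono (W : wellOrder) (x y : W) :
  olt (rk x) (rk y) <-> strict (@wo_le W) x y.
Proof.
have H u v : strict (@wo_le W) u v -> olt (rk u) (rk v).
  by move=> uv; apply/olt_rk; exists u.
split=> [xy|]; last exact: H.
case: (pselect (x = y)) => [e|ne].
  by case: (@olt_irr (rk y)); rewrite -{1}e.
case: (wo_total (wo_axiom W) x y) => // yx.
by case: (@olt_irr (rk x)); apply: olt_trans xy (H _ _ _); split=> // /esym.
Qed.

Lemma rk_inj (W : wellOrder) : injective (@rk W).
Proof.
move=> x y e; apply: contrapT => ne.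
case: (wo_total (wo_axiom W) x y) => h.
  have /rk_mono : strict (@wo_le W) x y by [].
  by rewrite e => /olt_irr.
have /rk_mono : strict (@wo_le W) y x by split=> // /esym.
by rewrite e => /olt_irr.
Qed.

(** Matching points of equal rank in representatives of [a] and [b] defines an isomorphism, because
    the same ranks occur in both. *)
Lemma olt_ext a b : (forall c, olt c a <-> olt c b) -> a = b.
Proof.
have [V ->] := otype_surj a; have [W ->] := otype_surj b => e.
have fP (x : V) : exists y : W, rk x = rk y.
  by apply/olt_otype/e/olt_otype; exists x.
have gP (y : W) : exists x : V, rk y = rk x.
  by apply/olt_otype/e/olt_otype; exists y.
pose f x := sval (cid (fP x)); pose g y := sval (cid (gP y)).
have fE x : rk (f x) = rk x by rewrite /f; case: cid.
have gE y : rk (g y) = rk y by rewrite /g; case: cid.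
apply: iso_otype; exists f.
  by exists g => x; apply: rk_inj; rewrite ?gE ?fE ?gE.
have le_rk (U : wellOrder) (x y : U) :
    wo_le x y <-> olt (rk x) (rk y) \/ rk x = rk y.
  case: (wo_order (wo_axiom U)) => r _ _.
  rewrite rk_mono; split=> [xy|[[]//|/rk_inj->]]; last exact: r.
  by case: (pselect (x = y)) => [->|]; [right|left].
by move=> x y; rewrite !le_rk !fE.
Qed.

(** Double induction: if [a] and [b] are not comparable, each ordinal below one is comparable with
    the other and must lie below it, and extensionality makes the two equal. *)
Lemma olt_total a b : a <> b -> olt a b \/ olt b a.
Proof.
suff : [\/ olt a b, a = b | olt b a] by case; [left| |right].
elim/(well_founded_ind olt_wf): a b => a IHa b.
elim/(well_founded_ind olt_wf): b => b IHb.
apply: contrapT => N; apply: (N); apply: Or32; apply: olt_ext => c; split=> h.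
  case: (IHa c h b) => // [e|bc]; case: N.
    by apply: Or33; rewrite -e.
  by apply: Or33; exact: olt_trans bc h.
case: (IHb c h) => // [ac|e]; case: N.
  by apply: Or31; exact: olt_trans ac h.
by apply: Or31; rewrite e.
Qed.

HB.instance Definition _ := gen_eqMixin ordinal_num.
HB.instance Definition _ := gen_choiceMixin ordinal_num.

Definition oleb (a b : ordinal_num) : bool := `[< ole a b >].
Definition oltb (a b : ordinal_num) : bool := `[< olt a b >].

Lemma oleb_def a b : oleb a b = (a == b) || oltb a b.
Proof.
apply/asboolP/orP => [[h|->]|[/eqP->|/asboolP h]]; last by left.
- by right; apply/asboolP.
- by left.
- by right.
Qed.

Lemma oltb_irr : irreflexive oltb.
Proof. by move=> a; apply/asboolP; exact: olt_irr. Qed.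

Lemma oltb_trans : transitive oltb.
Proof.
by move=> b a c /asboolP ab /asboolP bc; apply/asboolP; exact: olt_trans bc.
Qed.

Lemma oltb_total a b : a != b -> oltb a b || oltb b a.
Proof.
by move=> /eqP/olt_total[h|h]; apply/orP; [left|right]; apply/asboolP.
Qed.

Fact ordinal_display : Order.disp_t. Proof. exact: Order.Disp tt tt. Qed.

HB.instance Definition _ := @Order.LtOrder.Build ordinal_display ordinal_num
  oleb oltb _ _ oleb_def (fun _ _ => erefl) (fun _ _ => erefl)
  oltb_irr oltb_trans oltb_total.

Implicit Types a b c d : ordinal_num.

Lemma oltP a b : reflect (olt a b) (a < b).
Proof. exact: asboolP. Qed.

Lemma oleP a b : reflect (ole a b) (a <= b).
Proof. exact: asboolP. Qed.

Lemma ord_ind (P : ordinal_num -> Prop) :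
  (forall a, (forall b, b < a -> P b) -> P a) -> forall a, P a.
Proof.
by move=> H a; elim/(well_founded_ind olt_wf): a => a IH; apply: H => b /oltP/IH.
Qed.

Lemma ord_ext a b : (forall c, (c < a) = (c < b)) -> a = b.
Proof.
by move=> e; apply: olt_ext => c; split=> /oltP h; apply/oltP; rewrite ?e // -e.
Qed.

(** * Infima, suprema and the existence of bounds *)

Lemma oinfP (A : set ordinal_num) :
  A !=set0 -> A (oinf A) /\ forall b, A b -> ole (oinf A) b.
Proof.
move=> [a Aa]; rewrite /oinf; case: pselect => [h|[]]; first by case: cid.
elim/ord_ind: a Aa => a IH Aa.
case: (pselect (exists2 b, b < a & A b)) => [[b /IH]//|N].
exists a; split=> // b Ab; apply/oleP; rewrite leNgt; apply/negP => ba.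
by apply: N; exists b.
Qed.

Lemma oinf_mem (A : set ordinal_num) : A !=set0 -> A (oinf A).
Proof. by case/oinfP. Qed.

Lemma oinf_le (A : set ordinal_num) a : A a -> oinf A <= a.
Proof.
by move=> Aa; have [_ H] := oinfP (ex_intro _ a Aa); exact/oleP/H.
Qed.

(* [g] need not be injective: representatives of its fibres are chosen. *)
Lemma small_ordinal (Z : Type) (g : Z -> ordinal_num) :
  (forall z c, c < g z -> exists z', g z' = c) ->
  exists a, forall c, c < a <-> exists z, g z = c.
Proof.
move=> gdown.
pose rep c : option Z :=
  if pselect (exists z, g z = c) is left h then Some (sval (cid h)) else None.
pose X := {z : Z | rep (g z) = Some z}.
pose gX (x : X) := g (sval x).
have gX_inj : injective gX.
  move=> [x hx] [y hy]; rewrite /gX /= => e; apply: eq_exist.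
  by move: hx; rewrite e hy => -[].
have gX_surj c : (exists z, g z = c) -> exists x, gX x = c.
  move=> h.
  have := erefl (rep c); rewrite {2}/rep; case: pselect => // h' e.
  have ge : g (sval (cid h')) = c by case: cid.
  by exists (exist _ (sval (cid h')) (etrans (congr1 rep ge) e)).
have wo : is_well_order (fun x y : X => gX x <= gX y).
  split; first split.
  - by move=> x /=.
  - by move=> y x z /=; exact: le_trans.
  - by move=> x y /= xy yx; apply: gX_inj; apply/eqP; rewrite eq_le xy.
  - by move=> x y; apply/orP; exact: le_total.
  - suff H a (x : X) : gX x = a -> Acc (strict (fun x y => gX x <= gX y)) x.
      by move=> x; exact: H.
    elim/ord_ind: a x => a IH x e; constructor=> y [yx ne].
    apply: (IH (gX y)) => //; rewrite -e lt_neqAle yx andbT.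
    by apply/eqP => /gX_inj.
pose W := WellOrder wo.
(* Since the values of [g] are closed downwards, every ordinal below [gX x] is the value of an
   earlier point. *)
have rkE (x : W) : rk x = gX x.
  move: {2}(gX x) (erefl (gX x)) => a.
  elim/ord_ind: a x => a IH x e; apply: ord_ext => c; rewrite e.
  apply/idP/idP => [/oltP/olt_rk[y [yx ne] ->]|ca].
    have lt : gX y < a.
      by rewrite -e lt_neqAle [_ <= _]yx andbT; apply/eqP => /gX_inj.
    by rewrite (IH (gX y)).
  have [y yc] : exists y, gX y = c.
    by apply: gX_surj; apply: (gdown (sval x)); rewrite -/(gX x) e.
  apply/oltP/olt_rk; exists y; last by rewrite (IH c).
  split; first by rewrite /= yc e ltW.
  by move=> yx; move: ca; rewrite -yc -e yx ltxx.
exists (otype W) => c; split=> [/oltP/olt_otype[x ->]|/gX_surj[x <-]].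
  by rewrite rkE; exists (sval x).
by apply/oltP/olt_otype; exists x; rewrite rkE.
Qed.

(** Representatives of all the values are put side by side: [Some y] contributes the rank of a
    point, [None] the value itself. These contributions are closed downwards, hence exactly the
    ordinals below some [a]. *)
Lemma small_bound (X : Type) (g : X -> ordinal_num) :
  exists a, forall x, g x < a.
Proof.
have /choice[W WE] x : exists W, g x = otype W by exact: otype_surj.
pose h (z : {x & option (W x)}) := if tagged z is Some y then rk y else g (tag z).
have [|a aP] := @small_ordinal _ h.
  move=> [x [y|]] c /oltP; rewrite /h /=.
    by move=> /olt_rk[z _ ->]; exists (existT _ x (Some z)).
  by rewrite WE => /olt_otype[y ->]; exists (existT _ x (Some y)).
by exists a => x; apply: (aP _).2; exists (existT _ x None).
Qed.

Lemma below_bound a (g : ordinal_num -> ordinal_num) :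
  exists b, forall c, c < a -> g c < b.
Proof.
have [W ->] := otype_surj a; have [b bP] := small_bound (fun x : W => g (rk x)).
by exists b => c /oltP/olt_otype[x ->].
Qed.

Lemma osuccP a c : (c < osucc a) = (c <= a).
Proof.
have [b bP] := small_bound (fun _ : unit => a).
have : [set b | olt a b] (osucc a).
  by apply: oinf_mem; exists b; apply/oltP/(bP tt).
move=> /= /oltP h; apply/idP/idP => [lt|le]; last exact: le_lt_trans h.
rewrite leNgt; apply/negP => ac; move: lt; rewrite ltNge => /negP; apply.
by apply: oinf_le; apply/oltP.
Qed.

Lemma ltoS a : a < osucc a. Proof. by rewrite osuccP. Qed.

Lemma osucc_le a c : (osucc a <= c) = (a < c).
Proof. by rewrite leNgt osuccP -ltNge. Qed.

Lemma osucc_inj : injective osucc.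
Proof. by move=> a b e; apply/eqP; rewrite eq_le -!osuccP -e ltoS e ltoS. Qed.

Lemma lto0 a : (a < ozero) = false.
Proof. by apply/negP => /oltP/olt_otype[]; case. Qed.

Lemma le0o a : ozero <= a. Proof. by rewrite leNgt lto0. Qed.

Lemma gt0o a : (ozero < a) = (a != ozero).
Proof. by rewrite lt_neqAle le0o andbT eq_sym. Qed.

(** The bound [b] makes the class of upper bounds nonempty, so that [osup A] is not a junk value. *)
Lemma osup_lt (A : set ordinal_num) b c : (forall a, A a -> a <= b) ->
  c < osup A <-> exists2 a, A a & c < a.
Proof.
move=> Ab.
have up a : A a -> a <= osup A.
  have : [set b | forall a, A a -> ole a b] (osup A).
    by apply: oinf_mem; exists b => d /Ab/oleP.
  by move=> /= H /H/oleP.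
split=> [|[a /up + ca]]; last exact: lt_le_trans.
move=> cs; apply: contrapT => N; move: cs; rewrite ltNge => /negP; apply.
apply: oinf_le => a Aa; apply/oleP; rewrite leNgt; apply/negP => ca.
by apply: N; exists a.
Qed.

(** * Limit ordinals and transfinite recursion *)

Definition limit a := a != ozero /\ forall c, c < a -> osucc c < a.

Lemma limit_ind (P : ordinal_num -> Prop) :
  P ozero -> (forall a, P a -> P (osucc a)) ->
  (forall a, limit a -> (forall b, b < a -> P b) -> P a) ->
  forall a, P a.
Proof.
move=> P0 PS Pl; elim/ord_ind=> a IH.
have [->//|a0] := eqVneq a ozero.
case: (pselect (exists c, a = osucc c)) => [[c e]|N].
  by rewrite e; apply/PS/IH; rewrite e ltoS.
apply: Pl => //; split=> // c ca; rewrite lt_neqAle osucc_le ca andbT.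
by apply/eqP => e; apply: N; exists c.
Qed.

Section Recursion.
Variables (z : ordinal_num) (s : ordinal_num -> ordinal_num -> ordinal_num).

Lemma orec_unfold d : orec z s d =
  if pselect (d = ozero) then z
  else if pselect (exists c : below d, d = osucc (sval c)) is left h
  then let c := sval (cid h) in s (sval c) (orec z s (sval c))
  else osup [set orec z s (sval c) | c in [set: below d]].
Proof.
rewrite {1}/orec Fix_eq //.
move=> x f g fg; have -> // : f = g.
by apply: functional_extensionality_dep => y; exact/funext.
Qed.

Lemma orec0 : orec z s ozero = z.
Proof. by rewrite orec_unfold; case: pselect. Qed.

Lemma orecS c : orec z s (osucc c) = s c (orec z s c).
Proof.
rewrite orec_unfold; case: pselect => [e|/= _].
  by exfalso; have := ltoS c; rewrite e lto0.
case: pselect => [h|N]; first by case: cid => -[d hd] /= /osucc_inj->.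
by case: N; exists (exist _ c (oltP _ _ (ltoS c))).
Qed.

Lemma lt_orec_limit d c : limit d ->
  c < orec z s d <-> exists2 d', d' < d & c < orec z s d'.
Proof.
move=> [d0 dl]; rewrite orec_unfold.
case: pselect => [e|/= _]; first by move: d0; rewrite {1}e eqxx.
case: pselect => [[[d' d'd] /= e]|/= _].
  by exfalso; have /oltP/dl := d'd; rewrite -e ltxx.
(* The values taken below [d] have a common bound, so their supremum is genuine. *)
have [b bP] := below_bound d (orec z s).
rewrite (@osup_lt _ b).
  split=> [[_ [[d' d'd] _ <-] h]|[d' d'd h]]; first by exists d'; first exact/oltP.
  by exists (orec z s d') => //; exists (exist _ d' (oltP _ _ d'd)).
by move=> _ [[d' d'd] _ <-]; apply/ltW/bP/oltP.
Qed.

Lemma le_orec_limit d c : limit d -> c < d -> orec z s c <= orec z s d.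
Proof.
move=> ld cd; rewrite leNgt; apply/negP => lt.
have := (lt_orec_limit (orec z s d) ld).2.
by rewrite ltxx => /(_ (ex_intro2 _ _ c cd lt)).
Qed.

End Recursion.

(** * Comparing order types through increasing maps *)

Definition increasing_below d (g : ordinal_num -> ordinal_num) :=
  forall a b, a < b -> b < d -> g a < g b.

Lemma le_increasing d (g : ordinal_num -> ordinal_num) :
  increasing_below d g ->
  forall c, c < d -> c <= g c.
Proof.
move=> gm; elim/ord_ind=> c IH cd; rewrite leNgt; apply/negP => gc.
by have := gm _ _ gc cd; rewrite ltNge IH // (lt_trans gc).
Qed.

(* A strictly increasing map of a well-order into the ordinals dominates its
   rank. *)
Lemma otype_le (W : wellOrder) (g : W -> ordinal_num) a :
  (forall x y, strict (@wo_le W) x y -> g x < g y) -> (forall x, g x < a) ->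
  otype W <= a.
Proof.
move=> gm ga.
have rkg x : rk x <= g x.
  elim/(well_founded_ind (wo_wf (wo_axiom W))): x => x IH.
  rewrite leNgt; apply/negP => /oltP/olt_rk[y yx e].
  by have := gm _ _ yx; rewrite e ltNge IH.
rewrite leNgt; apply/negP => /oltP/olt_otype[x e].
by have := ga x; rewrite e ltNge rkg.
Qed.

Lemma otype_eq (W : wellOrder) (g : W -> ordinal_num) a :
  (forall x y, strict (@wo_le W) x y -> g x < g y) ->
  (forall c, c < a <-> exists x, g x = c) -> otype W = a.
Proof.
move=> gm ga; apply/eqP; rewrite eq_le (@otype_le _ g) //=; last first.
  by move=> x; apply/ga; exists x.
rewrite leNgt; apply/negP => lt.
(* If [otype W < a], sending an ordinal below [a] to the rank of its preimage under [g] is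
   increasing and so dominates the identity. At [otype W] this yields a point of [W] of rank at
   least [otype W], which is absurd. *)
have /choice[f fP] c : exists x, c < a -> g x = c.
  case: (pselect (c < a)) => [/ga[x <-]|]; first by exists x.
  by have [x _] := (ga _).1 lt; exists x.
have [x xE] := (ga _).1 lt.
have : otype W <= rk (f (otype W)).
  apply: (@le_increasing a (fun c => rk (f c))) => // c d cd da.
  have ca := lt_trans cd da.
  apply/oltP/rk_mono; have := fP c ca; have := fP d da.
  move: (f c) (f d) => y z zE yE.
  case: (pselect (y = z)) => [e|ne].
    by move: cd; rewrite -yE -zE e ltxx.
  case: (wo_total (wo_axiom W) y z) => // zy.
  have /gm : strict (@wo_le W) z y by split=> // /esym.
  by rewrite yE zE ltNge (ltW cd).
rewrite leNgt => /negP; apply; apply/oltP/olt_otype.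
by exists (f (otype W)).
Qed.

(** * Ordinal arithmetic *)

Lemma oadd0 a : oadd a ozero = a. Proof. exact: orec0. Qed.

Lemma oaddS a b : oadd a (osucc b) = osucc (oadd a b).
Proof. exact: orecS. Qed.

(** With the predecessors of a sum listed, most later laws of [oadd] follow by comparing
    predecessors instead of unfolding the recursion. *)
Lemma lt_oadd a b c :
  c < oadd a b <-> c < a \/ exists2 b', b' < b & c = oadd a b'.
Proof.
elim/limit_ind: b c => [|b IH|b lb IH] c.
- by rewrite oadd0; split=> [|[//|[b']]]; [left|rewrite lto0].
- rewrite oaddS osuccP le_eqVlt; split=> [/orP[/eqP->|/IH[h|[b' h ->]]]|].
  + by right; exists b; first exact: ltoS.
  + by left.
  + by right; exists b' => //; exact: lt_trans h (ltoS b).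
  + move=> [h|[b' + ->]]; first by apply/orP; right; apply/IH; left.
    rewrite osuccP le_eqVlt => /orP[/eqP->|h]; first by rewrite eqxx.
    by apply/orP; right; apply/IH; right; exists b'.
- rewrite (lt_orec_limit _ _ _ lb); split.
  + move=> [b' b'b] /(IH _ b'b)[h|[b'' h ->]]; first by left.
    by right; exists b'' => //; exact: lt_trans b'b.
  + move=> [h|[b' b'b ->]].
      by exists ozero; [rewrite gt0o; case: lb|rewrite -/(oadd _ _) oadd0].
    by exists (osucc b'); [exact: lb.2|rewrite -/(oadd _ _) oaddS ltoS].
Qed.

Lemma lt_oadd2l a b c : (oadd a b < oadd a c) = (b < c).
Proof.
have H x y : x < y -> oadd a x < oadd a y.
  by move=> xy; apply/lt_oadd; right; exists x.
apply/idP/idP => [lt|]; last exact: H.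
by rewrite ltNge le_eqVlt; apply/negP => /orP[/eqP e|/H /(lt_trans lt)];
  [move: lt; rewrite e ltxx|rewrite ltxx].
Qed.

Lemma le_oadd2l a b c : (oadd a b <= oadd a c) = (b <= c).
Proof. by rewrite !leNgt lt_oadd2l. Qed.

Lemma oaddI a : injective (oadd a).
Proof.
move=> b c e; apply/eqP.
by rewrite eq_le -(le_oadd2l a b) -(le_oadd2l a c) e lexx.
Qed.

Lemma le_oaddr a b : a <= oadd a b.
Proof. by rewrite -{1}(oadd0 a) le_oadd2l le0o. Qed.

Lemma le_oaddl a b : b <= oadd a b.
Proof.
apply: (@le_increasing (osucc b)); last exact: ltoS.
by move=> x y xy _; rewrite lt_oadd2l.
Qed.

Lemma oadd_sub a b : a <= b -> exists c, b = oadd a c.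
Proof.
move=> ab; have : b < oadd a (osucc b) by rewrite oaddS osuccP le_oaddl.
by case/lt_oadd=> [|[c _ ->]]; [rewrite ltNge ab|exists c].
Qed.

Lemma oaddA a b c : oadd a (oadd b c) = oadd (oadd a b) c.
Proof.
elim/ord_ind: c => c IH; apply: ord_ext => x; apply/idP/idP.
  case/lt_oadd=> [xa|[y /lt_oadd[yb|[z zc ->]] ->]].
  - by apply/lt_oadd; left; apply/lt_oadd; left.
  - by apply/lt_oadd; left; rewrite lt_oadd2l.
  - by rewrite IH // lt_oadd2l.
case/lt_oadd=> [/lt_oadd[xa|[y yb ->]]|[z zc ->]].
- by apply/lt_oadd; left.
- by rewrite lt_oadd2l; apply/lt_oadd; left.
- by rewrite -IH // !lt_oadd2l.
Qed.

Lemma add0o a : oadd ozero a = a.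
Proof.
elim/ord_ind: a => a IH; apply: ord_ext => x; apply/idP/idP.
  by case/lt_oadd=> [|[b ba ->]]; [rewrite lto0|rewrite IH].
by move=> xa; apply/lt_oadd; right; exists x; rewrite ?IH.
Qed.

Lemma le_oadd2r c a b : a <= b -> oadd a c <= oadd b c.
Proof. by move=> /oadd_sub[d ->]; rewrite -oaddA le_oadd2l le_oaddl. Qed.

Lemma omul_onat0 a : omul a (onat 0) = ozero. Proof. exact: orec0. Qed.

Lemma omul_onatS a n : omul a (onat n.+1) = oadd (omul a (onat n)) a.
Proof. exact: orecS. Qed.

Lemma omul_onat1 a : omul a (onat 1) = a.
Proof. by rewrite omul_onatS omul_onat0 add0o. Qed.

Lemma omul_onatD a m n :
  omul a (onat (m + n)) = oadd (omul a (onat m)) (omul a (onat n)).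
Proof.
elim: n => [|n IH]; first by rewrite addn0 omul_onat0 oadd0.
by rewrite addnS !omul_onatS IH oaddA.
Qed.

Lemma le_omul_onat a m n : (m <= n)%N -> omul a (onat m) <= omul a (onat n).
Proof. by move=> /subnKC <-; rewrite omul_onatD le_oaddr. Qed.

Lemma lt_onat c n : c < onat n <-> exists2 m, (m < n)%N & c = onat m.
Proof.
elim: n c => [|n IH] c; first by rewrite lto0; split=> // -[].
rewrite [onat _]/(osucc (onat n)) osuccP le_eqVlt; split.
  by move=> /orP[/eqP->|/IH[m mn ->]]; [exists n|exists m => //; exact: ltnW].
move=> [m + ->]; rewrite ltnS leq_eqVlt => /orP[/eqP->|mn]; first by rewrite eqxx.
by apply/orP; right; apply/IH; exists m.
Qed.

Lemma onatS_lt n : onat n < onat n.+1. Proof. exact: ltoS. Qed.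

Lemma onat_mono m n : (onat m < onat n) = (m < n)%N.
Proof.
have H i j : (i < j)%N -> onat i < onat j by move=> ij; apply/lt_onat; exists i.
case: (ltngtP m n) => [/H->//|/H h|->]; last exact: ltxx.
by apply/negbTE; rewrite -leNgt ltW.
Qed.

Lemma onat_inj : injective onat.
Proof.
by move=> m n e; case: (ltngtP m n) => // h; have := h;
  rewrite -onat_mono e ltxx.
Qed.

(** * Omega and its powers *)

Lemma lt_omega c : c < omega <-> exists n, c = onat n.
Proof.
have [b bP] := small_bound onat.
rewrite /omega (@osup_lt _ b); last by move=> _ [n _ <-]; exact: ltW.
split=> [[_ [n _ <-] /lt_onat[m _ ->]]|[n ->]]; first by exists m.
by exists (onat n.+1); [exists n.+1|exact: onatS_lt].
Qed.

Lemma limit_omega : limit omega.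
Proof.
split=> [|_ /lt_omega[n ->]]; last by apply/lt_omega; exists n.+1.
by rewrite -gt0o; apply/lt_omega; exists 0%N.
Qed.

Lemma lt_omul_omega a c :
  c < omul a omega <-> exists n, c < omul a (onat n).
Proof.
rewrite (lt_orec_limit _ _ _ limit_omega); split=> [[_ /lt_omega[n ->] h]|[n h]].
  by exists n.
by exists (onat n) => //; apply/lt_omega; exists n.
Qed.

Local Notation pw := (oexp omega).

Lemma pw0 : pw ozero = osucc ozero. Proof. exact: orec0. Qed.

Lemma pwS x : pw (osucc x) = omul (pw x) omega. Proof. exact: orecS. Qed.

(** Multiples of smaller powers are cofinal in [pw x], for successor and limit [x] alike. Zero is
    listed apart because [pw ozero] has no smaller power. *)
Lemma lt_pw x c : c < pw x <->
  c = ozero \/ exists y n, y < x /\ c < omul (pw y) (onat n).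
Proof.
elim/limit_ind: x c => [|x IH|x lx IH] c.
- rewrite pw0 osuccP le_eqVlt lto0 orbF.
  by split=> [/eqP|[->|[y [n [+ _]]]]]; [left|rewrite eqxx|rewrite lto0].
- rewrite pwS lt_omul_omega; split=> [[n h]|[->|[y [n []]]]].
  + by right; exists x, n; split=> //; exact: ltoS.
  + by exists 1%N; rewrite omul_onat1; apply/IH; left.
  + rewrite osuccP le_eqVlt => /orP[/eqP-> h|yx h]; first by exists n.
    by exists 1%N; rewrite omul_onat1; apply/IH; right; exists y, n.
- rewrite (lt_orec_limit _ _ _ lx) -/(oexp _); split.
  + move=> [x' x'x] /(IH _ x'x)[->|[y [n [yx h]]]]; first by left.
    by right; exists y, n; split=> //; exact: lt_trans x'x.
  + move=> [->|[y [n [yx h]]]].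
      exists ozero; first by rewrite gt0o; case: lx.
      by rewrite -/(oexp _ _) pw0 ltoS.
    exists (osucc y); first exact: lx.2.
    by rewrite -/(oexp _ _) pwS; apply/lt_omul_omega; exists n.
Qed.

Lemma pw_gt0 x : ozero < pw x. Proof. by apply/lt_pw; left. Qed.

Lemma omul_pw_lt x y n : y < x -> omul (pw y) (onat n) < pw x.
Proof.
move=> yx; apply/lt_pw; right; exists y, n.+1; split=> //.
by rewrite omul_onatS -{1}(oadd0 (omul _ _)) lt_oadd2l pw_gt0.
Qed.

Lemma lt_pw2 x y : (pw x < pw y) = (x < y).
Proof.
have H u v : u < v -> pw u < pw v.
  by move=> /(omul_pw_lt 1); rewrite omul_onat1.
case: (ltgtP x y) => [/H->//|/H h|->]; last exact: ltxx.
by apply/negbTE; rewrite -leNgt ltW.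
Qed.

Lemma le_pw2 x y : (pw x <= pw y) = (x <= y).
Proof. by rewrite !leNgt lt_pw2. Qed.

(** Nonzero summands lie below multiples of smaller powers. Replacing the multiple of the lesser
    power by one copy of the greater puts both over a single power, whose multiples add up. *)
Lemma oadd_pw_lt x a b : a < pw x -> b < pw x -> oadd a b < pw x.
Proof.
move=> /lt_pw[->|[y [m [yx ay]]]]; first by rewrite add0o.
move=> /lt_pw[->|[z [n [zx bz]]]].
  by rewrite oadd0; apply/lt_pw; right; exists y, m.
wlog yz : a b y z m n yx ay zx bz / y = z => [H|].
  case: (ltgtP y z) => [yz|zy|]; last by move/(H a b y z m n); exact.
    apply: (H a b z z 1%N n) => //; rewrite omul_onat1.
    exact/(lt_trans ay)/omul_pw_lt.
  apply: (H a b y y m 1%N) => //; rewrite omul_onat1.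
  exact/(lt_trans bz)/omul_pw_lt.
apply: lt_trans (omul_pw_lt (m + n) yx); rewrite omul_onatD.
by apply: le_lt_trans (le_oadd2r _ (ltW ay)) _; rewrite lt_oadd2l yz.
Qed.

Lemma oadd_pw_absorb x a : a < pw x -> oadd a (pw x) = pw x.
Proof.
move=> ax; apply/eqP; rewrite eq_le le_oaddl andbT leNgt; apply/negP.
by move=> /lt_oadd[/lt_trans/(_ ax)|[b /(oadd_pw_lt ax) h e]];
  [|move: h; rewrite -e]; rewrite ltxx.
Qed.

Lemma pw_ge x : x <= pw x.
Proof.
apply: (@le_increasing (osucc x)); last exact: ltoS.
by move=> u v uv _; rewrite lt_pw2.
Qed.

(** * Cantor normal forms *)

Local Notation desc := (sorted (fun x y : ordinal_num => `[< olt y x >])).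

Lemma cnf_cons x e p :
  cnf (x :: e) p = oadd (omul (pw x) (onat (p x))) (cnf e p).
Proof. by []. Qed.

Lemma cnf_lt (e : seq ordinal_num) p x : (forall y, y \in e -> y < x) -> cnf e p < pw x.
Proof.
elim: e => [|y e IH] H; first exact: pw_gt0.
rewrite cnf_cons oadd_pw_lt ?omul_pw_lt ?H ?mem_head // IH // => z ze.
by apply: H; rewrite inE ze orbT.
Qed.

Lemma eq_in_cnf e (p q : ordinal_num -> nat) : {in e, p =1 q} -> cnf e p = cnf e q.
Proof.
elim: e => [//|x e IH] pq; rewrite !cnf_cons pq ?mem_head // IH // => y ye.
by apply: pq; rewrite inE ye orbT.
Qed.

Lemma desc_cons x (e : seq ordinal_num) : desc (x :: e) <-> desc e /\ forall y, y \in e -> y < x.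
Proof.
rewrite /= (path_sortedE (leT := fun x y : ordinal_num => y < x)); last first.
  by move=> y z t /= yz ty; exact: lt_trans yz.
split=> [/andP[/allP h ?]|[? h]]; first by split.
by apply/andP; split=> //; apply/allP.
Qed.

Lemma cnf_exists a : exists e p,
  [/\ desc e, a = cnf e p & forall x, x \in e -> pw x <= a].
Proof.
elim/ord_ind: a => a IH.
have [->|a0] := eqVneq a ozero; first by exists [::], (fun=> 0%N).
(* The leading exponent is some [y < m]: a multiple of [pw y] exceeds [a], while [pw y] itself does
   not, by minimality of [m]. *)
pose m := oinf [set x | a < pw x].
have am : a < pw m.
  apply: (@oinf_mem [set x | a < pw x]); exists (osucc a) => /=.
  by apply: le_lt_trans (pw_ge a) _; rewrite lt_pw2 ltoS.
have ym y : y < m -> pw y <= a.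
  by rewrite leNgt => ym; apply/negP => ay; move: ym; rewrite ltNge oinf_le.
case/lt_pw: (am) => [e|[y [n0 [yltm]]]]; first by rewrite e eqxx in a0.
have pya := ym y yltm.
(* The induction finds the leading coefficient [n], for which [pw y] times [n] is the last multiple
   not above [a]. The remainder is then below [pw y]. *)
elim: n0 => [|n IHn]; first by rewrite omul_onat0 lto0.
rewrite omul_onatS => an; case: (ltP a (omul (pw y) (onat n))) => [/IHn//|na].
have [r rE] := oadd_sub na.
have ry : r < pw y by rewrite -(lt_oadd2l (omul (pw y) (onat n))) -rE.
have [e [p [de rp er]]] := IH r (lt_le_trans ry pya).
have ey z : z \in e -> z < y by move=> /er h; rewrite -lt_pw2 (le_lt_trans h).
exists (y :: e), (fun z => if z == y then n else p z); split.
- exact/desc_cons.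
- rewrite cnf_cons eqxx rE rp; congr oadd; apply: eq_in_cnf => z /ey zy.
  by rewrite lt_eqF.
- move=> z; rewrite inE => /predU1P[->//|/ey/ltW zy].
  by apply: le_trans pya; rewrite le_pw2.
Qed.

Lemma cnf_filter e p : cnf e p = cnf [seq x <- e | p x != 0%N] p.
Proof.
elim: e => [//|x e IH]; rewrite cnf_cons /= IH.
by case: eqVneq => [->|//]; rewrite omul_onat0 add0o.
Qed.

(** Once exponents with null coefficient are dropped, both lists are descending with the same
    members, hence equal. *)
Lemma cnf_extend (e u : seq ordinal_num) p : desc e -> desc u -> {subset e <= u} ->
  cnf e p = cnf u (fun x => if x \in e then p x else 0%N).
Proof.
move=> de du eu; set q := fun x => _.
have -> : cnf e p = cnf e q by apply: eq_in_cnf => x xe; rewrite /q xe.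
rewrite cnf_filter [RHS]cnf_filter; congr (cnf _ q).
pose R := fun x y : ordinal_num => y < x.
have tR : transitive R by move=> y x z xy yz; exact: lt_trans xy.
apply: (@irr_sorted_eq _ R) => //; first by move=> x; rewrite /R ltxx.
- exact: sorted_filter de.
- exact: sorted_filter du.
- move=> x; rewrite !mem_filter /q; case: ifP => // xe.
  by rewrite eu.
Qed.

Lemma desc_sort (u : seq ordinal_num) : exists v, desc v /\ u =i v.
Proof.
exists (sort (fun x y : ordinal_num => y <= x) (undup u)); split; last first.
  by move=> x; rewrite mem_sort mem_undup.
have /= := sort_sorted (fun x y => le_total y x) (undup u).
move=> s; have : uniq (sort (fun x y : ordinal_num => y <= x) (undup u)).
  by rewrite sort_uniq undup_uniq.
elim: (sort _ _) s => [//|x v IH] s /= /andP[xv uv].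
have sv := path_sorted s; apply/desc_cons; split; first exact: IH.
move: s; rewrite /= path_sortedE; last by move=> y z t yz ty; exact: le_trans yz.
move=> /andP[/allP h _] y yv; rewrite lt_neqAle h // andbT.
by apply: contraNneq xv => <-.
Qed.

Fixpoint lexlt (e : seq ordinal_num) (p q : ordinal_num -> nat) : Prop :=
  if e is x :: e' then (p x < q x)%N \/ p x = q x /\ lexlt e' p q else False.

(** At the first exponent where the coefficients differ, one more copy of [pw x] outweighs all that
    the smaller exponents contribute. *)
Lemma lexltP e p q : desc e -> lexlt e p q -> cnf e p < cnf e q.
Proof.
elim: e => [//|x e IH] /desc_cons[de ex]; rewrite !cnf_cons /=.
move=> [lt|[-> /(IH de)]].
  apply: (@lt_le_trans _ _ (omul (pw x) (onat (p x).+1))).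
    by rewrite omul_onatS lt_oadd2l cnf_lt.
  exact: le_trans (le_omul_onat _ lt) (le_oaddr _ _).
by rewrite lt_oadd2l.
Qed.

Lemma lex_total e (p q : ordinal_num -> nat) : [\/ lexlt e p q, {in e, p =1 q} | lexlt e q p].
Proof.
elim: e => [|x e IH]; first exact: Or32.
rewrite /=; case: (ltngtP (p x) (q x)) => h.
- by apply: Or31; left.
- by apply: Or33; left.
case: IH => h'; [by apply: Or31; right| |by apply: Or33; right].
by apply: Or32 => y; rewrite inE => /predU1P[->|/h'].
Qed.

Lemma lexlt_cnf e p q : desc e -> cnf e p < cnf e q -> lexlt e p q.
Proof.
move=> de lt.
case: (lex_total e p q) => // [/eq_in_cnf|/(lexltP de)/(lt_trans lt)].
  by move=> h; move: lt; rewrite h ltxx.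
by rewrite ltxx.
Qed.

Lemma cnf_inj e (p q : ordinal_num -> nat) : desc e -> cnf e p = cnf e q -> {in e, p =1 q}.
Proof.
by move=> de h; case: (lex_total e p q) => // /(lexltP de); rewrite h ltxx.
Qed.

Lemma lexltD e (p p' q q' : ordinal_num -> nat) : lexlt e p p' ->
  lexlt e q q' \/ {in e, q =1 q'} ->
  lexlt e (fun x => p x + q x)%N (fun x => p' x + q' x)%N.
Proof.
elim: e => [//|x e IH] /= [lt|[-> lt]].
  move=> [[lt'|[-> _]]|->]; rewrite ?mem_head //; left.
  - by rewrite -addSn leq_add // ltnW.
  - by rewrite ltn_add2r.
  - by rewrite ltn_add2r.
move=> [[lt'|[-> lt']]|h]; first by left; rewrite ltn_add2l.
  by right; split=> //; apply: IH => //; left.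
right; split; first by rewrite h ?mem_head.
by apply: IH => //; right => y ye; apply: h; rewrite inE ye orbT.
Qed.

(** * The natural sum *)

Lemma is_natural_sumC a b r : is_natural_sum a b r -> is_natural_sum b a r.
Proof.
move=> [e [p [q [de -> -> ->]]]]; exists e, q, p; split=> //.
by apply: eq_in_cnf => x _; rewrite addnC.
Qed.

(** Null coefficients bring both sums to a common list of exponents. There the order is
    lexicographic in the coefficients, and adding coefficients respects it. *)
Lemma is_natural_sum_lt a b r a' b' r' :
  is_natural_sum a b r -> is_natural_sum a' b' r' ->
  a < a' -> b <= b' -> r < r'.
Proof.
move=> [e [p [q [de -> -> ->]]]] [e' [p' [q' [de' -> -> ->]]]].
have [u [du uE]] := desc_sort (e ++ e').
have eu : {subset e <= u} by move=> x xe; rewrite -uE mem_cat xe.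
have eu' : {subset e' <= u} by move=> x xe; rewrite -uE mem_cat xe orbT.
rewrite !(cnf_extend _ de du eu) !(cnf_extend _ de' du eu').
set P := fun x => _; set P' := fun x => _ => lt.
set Q := fun x => _; set Q' := fun x => _ => le.
rewrite (@eq_in_cnf u _ (fun x => P x + Q x)%N); last first.
  by move=> x _; rewrite /P /Q; case: ifP.
rewrite (@eq_in_cnf u (fun x => if x \in e' then _ else _)
  (fun x => P' x + Q' x)%N); last first.
  by move=> x _; rewrite /P' /Q'; case: ifP.
apply: lexltP => //; apply: lexltD; first exact: lexlt_cnf.
move: le; rewrite le_eqVlt => /orP[/eqP/(cnf_inj du)|/(lexlt_cnf du)];
  by [right|left].
Qed.

Lemma natural_sumP a b : is_natural_sum a b (natural_sum a b).
Proof.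
apply: oinf_mem.
have [e [p [de aE _]]] := cnf_exists a; have [e' [q [de' bE _]]] := cnf_exists b.
have [u [du uE]] := desc_sort (e ++ e').
have eu : {subset e <= u} by move=> x xe; rewrite -uE mem_cat xe.
have eu' : {subset e' <= u} by move=> x xe; rewrite -uE mem_cat xe orbT.
rewrite (cnf_extend _ de du eu) in aE; rewrite (cnf_extend _ de' du eu') in bE.
by eexists; exists u; do 2!eexists; split; [|exact: aE|exact: bE|].
Qed.

Lemma natural_sum_ltl a a' b b' :
  a < a' -> b <= b' -> natural_sum a b < natural_sum a' b'.
Proof. exact: is_natural_sum_lt (natural_sumP _ _) (natural_sumP _ _). Qed.

Lemma natural_sum_ltr a a' b b' :
  a <= a' -> b < b' -> natural_sum a b < natural_sum a' b'.
Proof.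
move=> aa bb; apply: is_natural_sum_lt (is_natural_sumC (natural_sumP _ _)) _ bb aa.
exact: is_natural_sumC (natural_sumP _ _).
Qed.

Lemma le_natural_sum a b : a <= natural_sum a b.
Proof.
have [e [p [q [de -> _ ->]]]] := natural_sumP a b.
elim: e de => [//|x e IH] /desc_cons[de _]; rewrite !cnf_cons omul_onatD -oaddA.
by rewrite le_oadd2l; apply: le_trans (IH de) (le_oaddl _ _).
Qed.

(** The natural sum is strictly increasing in [b] and never below [a]; [oadd a] is the least
    function of this kind. *)
Lemma oadd_le_natural_sum a b : oadd a b <= natural_sum a b.
Proof.
elim/ord_ind: b => b IH; rewrite leNgt; apply/negP => /lt_oadd[lt|[c cb e]].
  by have := le_lt_trans (le_natural_sum a b) lt; rewrite ltxx.
by have := natural_sum_ltr (lexx a) cb; rewrite ltNge e IH.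
Qed.

(** At exponents from [x] on, [c] has null coefficients, so the terms of [a] are unchanged there.
    What remains of both has exponents below [x] and stays under [pw x]. *)
Lemma natural_sum_lt_oadd a c x : c < pw x -> natural_sum a c < oadd a (pw x).
Proof.
have [e [p [q [de -> -> ->]]]] := natural_sumP a c.
elim: e de => [|y e IH] /= de; first by rewrite add0o pw_gt0.
have /desc_cons[de' ey] := de.
have [xy|yx] := leP x y.
  have [q0 lt|q0 h] := posnP (q y).
    rewrite q0 addn0 -oaddA lt_oadd2l; apply: IH => //.
    by move: lt; rewrite q0 omul_onat0 add0o.
  have : pw x <= pw x by [].
  rewrite leNgt => /negP[]; apply: le_lt_trans h.
  apply: le_trans (le_oaddr _ _).
  apply: (@le_trans _ _ (pw y)); first by rewrite le_pw2.
  by rewrite -{1}(omul_onat1 (pw y)) le_omul_onat.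
move=> _; apply: lt_le_trans (le_oaddl _ _).
apply: (@cnf_lt (y :: e) (fun x => p x + q x)%N) => z.
rewrite inE => /predU1P[->//|/ey].
by move=> /lt_trans; exact.
Qed.

(** * Shuffles *)

(* The maps [h i], for [i] in [D], interleave the ordinals [s i] into [g]. *)
Record shuffle (I : Type) (D : set I) (s : I -> ordinal_num) (g : ordinal_num)
    (h : I -> ordinal_num -> ordinal_num) : Prop := Shuffle {
  shuffle_incr : forall i, D i -> increasing_below (s i) (h i);
  shuffle_lt : forall i a, D i -> a < s i -> h i a < g;
  shuffle_onto : forall c, c < g -> exists i a, [/\ D i, a < s i & h i a = c];
  shuffle_inj : forall i j a b, D i -> D j -> a < s i -> b < s j ->
    h i a = h j b -> i = j }.

(** Only finitely many of the interleaved ordinals have begun by position [c]; this is the source of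
    the finite sets in downward finiteness. *)
Definition locally_finite (I : Type) (D : set I) (s : I -> ordinal_num)
    (g : ordinal_num) (h : I -> ordinal_num -> ordinal_num) :=
  forall c, c < g ->
    finite_set [set i | D i /\ exists2 a, a < s i & h i a <= c].

Lemma increasing_below_le d (h : ordinal_num -> ordinal_num) a b :
  increasing_below d h -> a < d -> b < d -> (h a <= h b) = (a <= b).
Proof.
move=> hm ad bd.
case: (ltgtP a b) => [/hm/(_ bd)/ltW//|/hm/(_ ad)|->]; last exact: lexx.
by rewrite ltNge => /negbTE.
Qed.

(** Left subtraction, which recovers the offset inside the second summand of a sum. *)
Definition osub a b : ordinal_num := oinf [set c | a <= oadd b c].

Lemma oaddK b c : osub (oadd b c) b = c.
Proof.
apply/eqP; rewrite eq_le oinf_le /=; last exact: lexx.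
rewrite -(le_oadd2l b).
by apply: (@oinf_mem [set d | oadd b c <= oadd b d]); exists c => /=.
Qed.

Lemma oadd_ltF a b : (oadd a b < a) = false.
Proof. by rewrite ltNge le_oaddr. Qed.

(** The second shuffle is placed after the first, and the map of each index continues from one block
    into the other. *)
Lemma shuffle_oadd (I : Type) (D : set I) s g h s' g' h' :
  shuffle D s g h -> shuffle D s' g' h' ->
  exists k, shuffle D (fun i => oadd (s i) (s' i)) (oadd g g') k.
Proof.
move=> [hi hl ho hj] [hi' hl' ho' hj'].
exists (fun i c => if c < s i then h i c else oadd g (h' i (osub c (s i)))).
split=> [i Di a b ab|i a Di|c|i j a b Di Dj].
- case/lt_oadd=> [bs|[b' b's e]]; first by rewrite bs (lt_trans ab bs) hi.
  rewrite e oadd_ltF oaddK.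
  case: ifP => as'; first exact: lt_le_trans (hl _ _ Di as') (le_oaddr _ _).
  have /oadd_sub[a' a'E] : s i <= a by rewrite leNgt as'.
  move: ab; rewrite e a'E oaddK !lt_oadd2l => ab; exact: hi'.
- case/lt_oadd=> [as'|[a' a's ->]].
    by rewrite as'; exact: lt_le_trans (hl _ _ Di as') (le_oaddr _ _).
  by rewrite oadd_ltF oaddK lt_oadd2l hl'.
- case/lt_oadd=> [/ho[i [a [Di ai <-]]]|[d /ho'[i [a [Di ai <-]]] ->]].
    by exists i, a; split=> //; [exact: lt_le_trans (le_oaddr _ _)|rewrite ai].
  exists i, (oadd (s i) a); split=> //; first by rewrite lt_oadd2l.
  by rewrite oadd_ltF oaddK.
- case/lt_oadd=> [ai|[a' ai ->]]; case/lt_oadd=> [bj|[b' bj ->]].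
  + by rewrite ai bj; exact: hj.
  + rewrite ai oadd_ltF => e.
    by have := hl _ _ Di ai; rewrite e oadd_ltF.
  + rewrite bj oadd_ltF => e.
    by have := hl _ _ Dj bj; rewrite -e oadd_ltF.
  + by rewrite !oadd_ltF !oaddK => /oaddI; exact: hj'.
Qed.

Lemma shuffle_concat (s : bool -> ordinal_num) :
  exists h, shuffle [set: bool] s (oadd (s false) (s true)) h.
Proof.
exists (fun i c => if i then oadd (s false) c else c).
split=> [[] _ a b ab _|[] a _ lt|c|]; rewrite ?lt_oadd2l //.
- exact: lt_le_trans lt (le_oaddr _ _).
- by case/lt_oadd=> [lt|[d lt ->]]; [exists false, c|exists true, d].
- move=> [] [] a b _ _ // lt lt' e.
    by move: lt'; rewrite -e oadd_ltF.
  by move: lt; rewrite e oadd_ltF.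
Qed.

(** For each exponent the copies of [pw x] counted by [p] are followed by those counted by [q], and
    these blocks are joined along [e]. *)
Lemma shuffle_cnf e p q : exists h, shuffle [set: bool]
  (fun i => cnf e (if i then q else p)) (cnf e (fun x => p x + q x)%N) h.
Proof.
elim: e => [|x e [h hP]].
  exists (fun _ c => c); split=> [i _ a b ab|i a _|c|i j a b _ _] /=;
    by rewrite lto0.
have [k kP] := shuffle_concat
  (fun i => omul (pw x) (onat ((if i then q else p : ordinal_num -> nat) x))).
have [f fP] := shuffle_oadd kP hP; exists f.
by rewrite cnf_cons omul_onatD.
Qed.

Lemma shuffle_natural_sum a b : exists h, shuffle [set: bool]
  (fun i => if i then b else a) (natural_sum a b) h.
Proof.
have [e [p [q [_ aE bE rE]]]] := natural_sumP a b.
have [h hP] := shuffle_cnf e p q; exists h; rewrite rE; move: hP.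
by congr shuffle; apply/funext => -[].
Qed.

(** * Shuffles of sequences *)

Fixpoint psum (s : nat -> ordinal_num) n : ordinal_num :=
  if n is m.+1 then natural_sum (psum s m) (s m) else ozero.

Lemma psum_le s m n : (m <= n)%N -> psum s m <= psum s n.
Proof.
move=> /subnKC <-; elim: (n - m)%N => [|k IH]; first by rewrite addn0.
by rewrite addnS; apply: le_trans IH (le_natural_sum _ _).
Qed.

Lemma shuffle_psum s n : exists h, shuffle `I_n s (psum s n) h.
Proof.
elim: n => [|n [h hP]].
  by exists (fun _ c => c); split=> // c; rewrite lto0.
have [k [ki kl ko kj]] := shuffle_natural_sum (psum s n) (s n).
exists (fun i c => if (i < n)%N then k false (h i c) else k true c).
have In i : `I_n.+1 i -> (i < n)%N \/ i = n /\ (i < n)%N = false.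
  rewrite /= ltnS leq_eqVlt => /predU1P[->|]; last by left.
  by right; rewrite ltnn.
split=> [i /In[Di|[-> ->]] a b ab bi|i a /In[Di|[-> ->]] ai|c|i j a b].
- rewrite Di; apply: (ki false) => //; last exact: (shuffle_lt hP).
  exact: (shuffle_incr hP).
- exact: (ki true).
- by rewrite Di; apply: (kl false) => //; exact: (shuffle_lt hP).
- exact: (kl true).
- move=> /ko[[] [a [_ ac <-]]]; first by exists n, a; split; rewrite /= ?ltnn.
  have [i [b [Di bi <-]]] := shuffle_onto hP ac.
  by exists i, b; split=> //; [exact: ltnW|rewrite Di].
- move=> /In[Di|[-> ->]] /In[Dj|[-> ->]] ai bj; rewrite ?Di ?Dj //.
  (* Injectivity of a shuffle only identifies indices; that [k false] separates arguments comes from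
     its being increasing. *)
  + move=> e; apply: (shuffle_inj hP Di Dj ai bj); apply/eqP; rewrite eq_le.
    have hi := shuffle_lt hP Di ai; have hj := shuffle_lt hP Dj bj.
    rewrite -(increasing_below_le (ki false I) hi hj).
    by rewrite -(increasing_below_le (ki false I) hj hi) e lexx.
  + by move=> /(kj false true _ _ I I (shuffle_lt hP Di ai) bj).
  + by move=> /(kj true false _ _ I I ai (shuffle_lt hP Dj bj)).
Qed.

(* With [l] least such that [s n < pw l] eventually, the tail can be appended
   in ordinary succession: it has supremum [pw l] under both sums. *)
Lemma shuffle_sup (s : nat -> ordinal_num) : (forall n, ozero < s n) ->
  exists g, [/\ forall c, c < g <-> exists n, c < psum s n &
    exists h, shuffle [set: nat] s g h /\ locally_finite [set: nat] s g h].
Proof.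
move=> s_gt0.
pose L := [set l | exists N, forall n, (N <= n)%N -> s n < pw l].
pose l := oinf L.
have [N NP] : L l.
  apply: oinf_mem; have [b bP] := small_bound s.
  by exists b, 0%N => n _; exact: lt_le_trans (bP n) (pw_ge b).
(* By minimality of [l], terms of size at least [pw y] occur arbitrarily late. *)
have lmin y n : y < l -> exists2 m, (n <= m)%N & pw y <= s m.
  move=> yl; apply: contrapT => H; move: yl; rewrite ltNge oinf_le //.
  exists n => m nm; rewrite ltNge; apply/negP => le; by apply: H; exists m.
pose t := fix t n := if n is m.+1 then oadd (t m) (s (N + m)%N) else ozero.
have tS n : t n.+1 = oadd (t n) (s (N + n)%N) by [].
have t_le m n : (m <= n)%N -> t m <= t n.
  move=> /subnKC <-; elim: (n - m)%N => [|k IH]; first by rewrite addn0.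
  by rewrite addnS tS; apply: le_trans IH (le_oaddr _ _).
have t_lt n : t n < pw l.
  elim: n => [|n IH]; first exact: pw_gt0.
  by rewrite tS oadd_pw_lt // NP // leq_addr.
(* Each late term of size at least [pw y] adds one more copy of [pw y], so the ordinary sums [t] of
   the tail pass every multiple of it. *)
have t_cof c : c < pw l -> exists n, c < t n.
  case/lt_pw=> [->|[y [k [yl ck]]]].
    by exists 1%N; rewrite tS add0o.
  suff [n] : exists n, omul (pw y) (onat k) <= t n.
    by exists n; exact: lt_le_trans ck _.
  elim: k {ck} => [|k [n IH]]; first by exists 0%N; rewrite omul_onat0.
  have [m nm ym] := lmin y (N + n)%N yl.
  have Nm : (N <= m)%N by exact: leq_trans (leq_addr _ _) nm.
  exists (m - N).+1; rewrite tS subnKC // omul_onatS.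
  apply: le_trans (le_oadd2r _ IH) _.
  apply: le_trans (le_oadd2r _ (_ : _ <= t (m - N)%N)) _; last by rewrite le_oadd2l.
  by apply: t_le; rewrite leq_subRL.
have t_split c : c < pw l -> exists k a, a < s (N + k)%N /\ c = oadd (t k) a.
  move=> /t_cof[n]; elim: n => [|n IH]; first by rewrite lto0.
  rewrite tS => /lt_oadd[/IH//|[a ac ->]]; by exists n, a.
pose B := psum s N; pose g := oadd B (pw l).
exists g; split=> [c|].
  split=> [/lt_oadd[cB|[d /t_cof[n dn] ->]]|[n cn]]; first by exists N.
    exists (N + n)%N; apply: (@lt_le_trans _ _ (oadd B (t n))).
      by rewrite lt_oadd2l.
    elim: n {dn} => [|n IH]; first by rewrite addn0 oadd0.
    rewrite addnS tS oaddA; apply: le_trans (le_oadd2r _ IH) _.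
    exact: oadd_le_natural_sum.
  apply: (lt_trans cn); apply: (@le_lt_trans _ _ (psum s (N + n))).
    by apply: psum_le; rewrite leq_addl.
  elim: n {cn} => [|n IH].
    by rewrite addn0 -{1}(oadd0 (psum s N)) lt_oadd2l pw_gt0.
  rewrite addnS /=.
  (* The excess [d] over [B] is below [pw l] and is absorbed by it, so adding a further term below
     [pw l] cannot reach [oadd B (pw l)]. *)
  have /oadd_sub[d dE] : B <= psum s (N + n) by apply: psum_le; rewrite leq_addr.
  have dl : d < pw l by rewrite -(lt_oadd2l B) -dE.
  have := natural_sum_lt_oadd (psum s (N + n)) (NP (N + n)%N (leq_addr _ _)).
  by rewrite {2}dE -oaddA oadd_pw_absorb.
have [h0 [hi hl ho hj]] := shuffle_psum s N.
(* The first [N] ordinals are shuffled into [B]; the tail follows in successive blocks, that of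
   index [N + k] starting at [oadd B (t k)]. *)
pose h i c := if (i < N)%N then h0 i c else oadd B (oadd (t (i - N)%N) c).
have h_tail k c : h (N + k)%N c = oadd B (oadd (t k) c).
  by rewrite /h ltnNge leq_addr /= addKn.
have h_head i c : (i < N)%N -> h i c = h0 i c by rewrite /h => ->.
have nP i : (i < N)%N \/ exists k, i = (N + k)%N.
  by case: (ltnP i N) => [|/subnKC <-]; [left|right; eexists].
have tail_lt k a : a < s (N + k)%N -> oadd (t k) a < t k.+1.
  by rewrite tS lt_oadd2l.
have h_lt i a : (i < N)%N -> a < s i -> h i a < B.
  by move=> iN ai; rewrite h_head //; exact: hl.
exists h; split; first split=> [i _ a b ab bi|i a _|c|].
- case: (nP i) => [iN|[k ik]]; first by rewrite !h_head // hi.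
  by rewrite ik !h_tail !lt_oadd2l.
- case: (nP i) => [iN ai|[k -> ai]].
    exact: lt_le_trans (h_lt _ _ iN ai) (le_oaddr _ _).
  by rewrite h_tail lt_oadd2l; apply: lt_trans (tail_lt _ _ ai) (t_lt _).
- case/lt_oadd=> [/ho[i [a [iN ai <-]]]|[d /t_split[k [a [ak ->]]] ->]].
    by exists i, a; split=> //; rewrite h_head.
  by exists (N + k)%N, a; split=> //; rewrite h_tail.
- move=> i j a b _ _; case: (nP i) => [iN|[k ->]]; case: (nP j) => [jN|[m ->]] ai bj.
  + by rewrite !h_head //; exact: hj.
  + by rewrite h_tail => e; have := h_lt _ _ iN ai; rewrite e oadd_ltF.
  + by rewrite h_tail => e; have := h_lt _ _ jN bj; rewrite -e oadd_ltF.
  + rewrite !h_tail => /oaddI e; congr addn.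
    case: (ltngtP k m) => // /t_le.
      move=> /(lt_le_trans (tail_lt _ _ ai)).
      by rewrite e oadd_ltF.
    move=> /(lt_le_trans (tail_lt _ _ bj)).
    by rewrite -e oadd_ltF.
- move=> c cg.
  (* Some block boundary lies beyond [c], and the indices from [N + M] on start too late. *)
  have [M MP] : exists M, c < oadd B (t M).
    case/lt_oadd: cg => [cB|[d /t_cof[M dM] ->]].
      by exists 0%N; rewrite oadd0.
    by exists M; rewrite lt_oadd2l.
  apply: (@sub_finite_set _ _ `I_(N + M)) => // i [_ [a ai]].
  case: (nP i) => [iN _|[k ->]]; first exact: leq_trans iN (leq_addr _ _).
  rewrite h_tail => /le_lt_trans/(_ MP); rewrite lt_oadd2l => lt.
  rewrite /= ltn_add2l ltnNge; apply/negP => /t_le le.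
  by have := le_lt_trans (le_oaddr _ _) lt; rewrite ltNge le.
Qed.

Lemma shuffle_reindex (I J : Type) (f : J -> I) (D : set I) s g h :
  injective f -> (forall i, D i <-> exists j, f j = i) ->
  shuffle D s g h -> shuffle [set: J] (s \o f) g (h \o f).
Proof.
move=> fI fD [hi hl ho hj].
have Df j : D (f j) by apply/fD; exists j.
split=> [j _|j a _|c /ho[i [a [/fD[j <-] aj <-]]]|j j' a b _ _ aj bj /hj e].
- exact: hi.
- exact: hl.
- by exists j, a.
- exact/fI/e.
Qed.

(** * Countable families *)

Lemma countable_index (I : Type) : countable [set: I] ->
  exists (f : I -> nat) (d : ordinal_num),
    [/\ injective f, forall n, onat n < d <-> exists i, f i = n &
        d = omega \/ exists n, d = onat n].
Proof.
move=> cI; case: (pselect (finite_set [set: I])) => [/finite_setP[n]|nf].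
  move=> /card_set_bijP[f [fI fi fs]]; exists f, (onat n); split.
  - by move=> i j; apply: fi; rewrite inE.
  - move=> m; rewrite onat_mono; split=> [/fs[i _ <-]|[i <-]]; first by exists i.
    exact: fI.
  - by right; exists n.
have /card_set_bijP[f [fI fi fs]] := eq_card_nat cI nf; exists f, omega; split.
- by move=> i j; apply: fi; rewrite inE.
- move=> m; split=> [_|_]; last by apply/lt_omega; exists m.
  by have [i _ <-] := fs m Logic.I; exists i.
- by left.
Qed.

Lemma countable_shuffle (I : Type) (a : I -> ordinal_num) :
  countable [set: I] -> (forall i, ozero < a i) ->
  exists (d : ordinal_num) (f : below d -> I), bijective f /\
    exists h, let g := iter_natural_sum (fun c : below d => a (f c)) in
      shuffle [set: I] a g h /\ locally_finite [set: I] a g h.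
Proof.
move=> /countable_index[f [d [fI fd dP]]] a_gt0.
have onat_lt i : olt (onat (f i)) d by apply/oltP/fd; exists i.
have kP (c : below d) : exists i, onat (f i) = sval c.
  case: c => c cd /=; have /oltP lt := cd.
  have [n e] : exists n, c = onat n.
    case: dP => [dE|[m dE]]; move: lt; rewrite dE; first by move/lt_omega.
    by case/lt_onat=> n _ ->; exists n.
  by move: lt; rewrite e => /fd[i <-]; exists i.
pose k (c : below d) := sval (cid (kP c)).
have kE (c : below d) : onat (f (k c)) = sval c by rewrite /k; case: cid.
have kK i h : k (exist _ (onat (f i)) h) = i.
  by apply/fI/onat_inj; rewrite kE.
exists d, k; split.
  exists (fun i => exist (olt^~ d) _ (onat_lt i)) => [[c cd]|i]; last exact: kK.
  by apply: eq_exist; rewrite kE.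
(* The default [ozero] occurs only outside [d], hence never when [d] is [omega], where all terms
   must be nonzero. *)
pose s n := if pselect (olt (onat n) d) is left h
  then a (k (exist _ (onat n) h)) else ozero.
have sE i : s (f i) = a i by rewrite /s; case: pselect => // h; rewrite kK.
set g := iter_natural_sum _.
have gE n : orec ozero (fun c r => natural_sum r
    (if pselect (olt c d) is left h then a (k (exist _ c h)) else ozero)) (onat n) =
    psum s n.
  by elim: n => [|n IH]; [exact: orec0|rewrite [LHS]orecS IH].
have aE : a = s \o f by apply/funext => i /=; rewrite sE.
case: dP => [dE|[n dE]]; last first.
  have [h hP] := shuffle_psum s n; exists (h \o f).
  have {}gE : g = psum s n by rewrite -gE -dE.
  have fin : finite_set [set: I].
    suff -> : [set: I] = f @^-1` `I_n.
      by apply: finite_preimage => // i j _ _; exact: fI.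
    apply/seteqP; split=> i //= _; rewrite -onat_mono -dE.
    by apply/fd; exists i.
  split; last by move=> c _; exact: sub_finite_set fin.
  rewrite gE aE; apply: shuffle_reindex hP => // m.
  by rewrite /= -onat_mono -dE.
have surj n : exists i, f i = n.
  by apply/fd; rewrite dE; apply/lt_omega; exists n.
have [|g' [g'E [h [hP hf]]]] := @shuffle_sup s.
  by move=> n; have [i <-] := surj n; rewrite sE.
have gg' : g = g'.
  have ld : limit d by rewrite dE; exact: limit_omega.
  apply: ord_ext => c; apply/idP/idP.
    move=> /(lt_orec_limit _ _ _ ld)[c' c'd cc'].
    have /lt_omega[n e] : c' < omega by rewrite -dE.
    by move: cc'; rewrite e gE => cc'; apply/g'E; exists n.
  move=> /g'E[n h']; apply/(lt_orec_limit _ _ _ ld); exists (onat n).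
    by rewrite dE; apply/lt_omega; exists n.
  by rewrite gE.
exists (h \o f); rewrite /= gg'; split.
  by rewrite aE; apply: shuffle_reindex hP => // n; split=> // _; exact: surj.
move=> c cg; apply: sub_finite_set (finite_preimage (f := f) _ (hf c cg)).
  by move=> i [_ [x xi xc]]; split=> //; exists x; rewrite ?sE.
by move=> i j _ _; exact: fI.
Qed.

(** * Bounding order types by sums *)

Section Ranked.
Variables (T : Type) (lt : relation T).
Hypothesis lt_tr : forall x y z, lt x y -> lt y z -> lt x z.

(** A certificate that [S] has type at most [a], which passes to subsets without forming a
    suborder. *)
Definition ranked (S : set T) a :=
  exists2 g : T -> ordinal_num, forall x, S x -> g x < a &
    forall x y, S x -> S y -> lt x y -> g x < g y.

Lemma ranked_sub S S' a b : S `<=` S' -> a <= b -> ranked S' a -> ranked S b.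
Proof.
move=> SS' ab [g ga gm]; exists g => [x /SS'/ga/lt_le_trans|x y /SS' Sx /SS'].
  exact.
exact: gm.
Qed.

(** Each ranking is lifted to all points by taking the least strict bound of the values below the
    point. From [x] to a later [y] neither lift decreases, and the lift for a piece containing [x]
    increases strictly, as does then the natural sum. *)
Lemma ranked_setU S S' a b :
  ranked S a -> ranked S' b -> ranked (S `|` S') (natural_sum a b).
Proof.
pose lift (R : set T) (g : T -> ordinal_num) x :=
  oinf [set c | forall y, R y -> lt y x -> g y < c].
have liftP R g c x y : (forall x, R x -> g x < c) -> R y -> lt y x ->
    g y < lift R g x.
  move=> gc Ry yx.
  apply: (@oinf_mem [set c | forall y, R y -> lt y x -> g y < c]) => //.
  by exists c => z Rz _; exact: gc.
have lift_mono R g c x y : (forall x, R x -> g x < c) -> lt x y ->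
    lift R g x <= lift R g y.
  move=> gc xy; apply: oinf_le => z Rz zx; apply: (liftP _ _ c) => //.
  exact: lt_tr zx xy.
have lift_le R g x : R x -> (forall x y, R x -> R y -> lt x y -> g x < g y) ->
    lift R g x <= g x.
  by move=> Rx gm; apply: oinf_le => z Rz zx; exact: gm.
have lift_lt R g c x : (forall x, R x -> g x < c) -> lift R g x <= c.
  by move=> gc; apply: oinf_le => z Rz _; exact: gc.
move=> [g ga gm] [h hb hm].
exists (fun x => natural_sum (lift S g x) (lift S' h x)) => [x|x y] Sx.
  case: Sx => Sx.
    apply: natural_sum_ltl; last exact: lift_lt.
    exact: le_lt_trans (lift_le _ _ _ Sx gm) (ga _ Sx).
  apply: natural_sum_ltr; first exact: lift_lt.
  exact: le_lt_trans (lift_le _ _ _ Sx hm) (hb _ Sx).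
move=> _ xy; case: Sx => Sx; [apply: natural_sum_ltl|apply: natural_sum_ltr].
- exact: le_lt_trans (lift_le _ _ _ Sx gm) (liftP _ _ _ _ _ ga Sx xy).
- exact: lift_mono hb xy.
- exact: lift_mono ga xy.
- exact: le_lt_trans (lift_le _ _ _ Sx hm) (liftP _ _ _ _ _ hb Sx xy).
Qed.

(* The least rank of [x] over all rankings of its closed initial segment is a
   ranking of the whole. *)
Lemma ranked_initial S a :
  (forall x, S x -> ranked [set y | S y /\ (y = x \/ lt y x)] a) -> ranked S a.
Proof.
move=> H; pose R x := [set y | S y /\ (y = x \/ lt y x)].
pose A x := [set c | exists g : T -> ordinal_num,
  [/\ forall y, R x y -> g y < a,
      forall y z, R x y -> R x z -> lt y z -> g y < g z & g x = c]].
have Rx x : S x -> R x x by split=> //; left.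
have AP x : S x -> A x (oinf (A x)).
  by move=> Sx; have [g ga gm] := H x Sx; apply: oinf_mem; exists (g x), g.
exists (fun x => oinf (A x)) => [x Sx|x y Sx Sy xy].
  by have [g [ga _ <-]] := AP x Sx; exact/ga/Rx.
have [g [ga gm gE]] := AP y Sy; rewrite -gE.
have xR : R x `<=` R y.
  by move=> z [Sz [->|zx]]; split=> //; right=> //; exact: lt_tr zx xy.
apply: (@le_lt_trans _ _ (g x)); last first.
  by apply: gm => //; [exact/xR/Rx|exact: Rx].
apply: oinf_le; exists g; split=> // [z /xR/ga//|z z' /xR Rz /xR Rz'].
exact: gm.
Qed.

(** Finiteness of [l] serves at limits: the members of [l] below a limit [c] lie below some
    [c' < c], so the sum up to [c'] already suffices. *)
Lemma ranked_finite_sum d (a : below d -> ordinal_num) (X : below d -> set T)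
    (l : seq ordinal_num) : (forall k, ranked (X k) (a k)) ->
  ranked [set x | exists2 k : below d, sval k \in l & X k x]
    (iter_natural_sum a).
Proof.
move=> Xa; rewrite /iter_natural_sum.
set F := orec _ _.
suff H c : c <= d ->
    ranked [set x | exists k : below d, [/\ sval k \in l, sval k < c & X k x]]
      (F c).
  apply: ranked_sub (H d (lexx d)) => // x [k kl kx].
  by exists k; split=> //; apply/oltP/(svalP k).
elim/limit_ind: c => [_|c IH cd|c lc IH cd].
- by exists (fun=> ozero) => [x|x y] [k []]; rewrite lto0.
- have cd' : c < d by exact: lt_le_trans (ltoS c) cd.
  rewrite /F orecS -/F; case: pselect => [h|/oltP]; last by rewrite cd'.
  apply: ranked_sub (lexx _) (ranked_setU (IH (ltW cd')) (Xa (exist _ c h))).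
  move=> x [k [kl]]; rewrite osuccP le_eqVlt => /predU1P[kc|kc] kx.
    right; suff -> : exist _ c h = k by [].
    by case: k kc {kl kx} => k ? /= kc; exact: eq_exist.
  by left; exists k.
- have [c' c'c lc'] : exists2 c', c' < c & forall x, x \in l -> x < c -> x < c'.
    elim: l {F IH} => [|x l [c' c'c IH]].
      by exists ozero; rewrite // gt0o; case: lc.
    have [xc|xc] := ltP x c; last first.
      exists c' => // y; rewrite inE => /predU1P[->|/IH//].
      by rewrite ltNge xc.
    exists (Order.max c' (osucc x)) => [|y]; first by rewrite gt_max c'c lc.2.
    by rewrite inE lt_max => /predU1P[->|/IH h /h ->//]; rewrite ltoS orbT.
  apply: ranked_sub (IH c' c'c (ltW (lt_le_trans c'c cd))).
    by move=> x [k [kl kc kx]]; exists k; split=> //; exact: lc'.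
  exact: le_orec_limit.
Qed.

(** Some enumeration attains the infimum, and along it the pieces meeting a closed initial segment
    occupy finitely many positions. Since each such segment is bounded by the sum, so is [S]. *)
Lemma ranked_big_sum (I : Type) (a : I -> ordinal_num) (X : I -> set T) S :
  (exists (d : ordinal_num) (f : below d -> I), bijective f) ->
  (forall i, ranked (X i) (a i)) ->
  (forall x, S x -> exists2 K : set I, finite_set K &
     forall y, S y -> y = x \/ lt y x -> exists2 i, K i & X i y) ->
  ranked S (big_natural_sum a).
Proof.
move=> [d0 [f0 f0b]] Xa cov; rewrite /big_natural_sum.
have [|d [f [[f' fK f'K] ->]]] := @oinf_mem [set r | exists (d : ordinal_num)
    (f : below d -> I), bijective f /\
      r = iter_natural_sum (fun c : below d => a (f c))].
  by eexists; exists d0, f0.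
apply: ranked_initial => x Sx; have [K Kf KP] := cov x Sx.
have /finite_seqP[l lE] := finite_image (fun i => sval (f' i)) Kf.
apply: ranked_sub (lexx _) (ranked_finite_sum (X := X \o f) l (fun k => Xa (f k))).
move=> y [Sy yx]; have [i Ki Xy] := KP y Sy yx; exists (f' i).
  by have : [set` l] (sval (f' i)) by rewrite -lE; exists i.
by rewrite /= f'K.
Qed.

End Ranked.

(** The images of the maps [h i] cover the ordinals below [g] by pieces of types [a i], finitely
    many before each point, so the general bound applies. A sum smaller than [g] would be ranked
    below itself by an increasing map. *)
Lemma shuffle_le_big_sum (I : Type) (a : I -> ordinal_num) g h :
  (exists (d : ordinal_num) (f : below d -> I), bijective f) ->
  shuffle [set: I] a g h -> locally_finite [set: I] a g h ->
  g <= big_natural_sum a.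
Proof.
move=> ex [hi hl ho hj] hf.
pose lt (x y : ordinal_num) : Prop := x < y.
have lt_tr x y z : lt x y -> lt y z -> lt x z by exact: lt_trans.
have [||k kg km] := @ranked_big_sum _ lt lt_tr I a
    (fun i => [set c | exists2 b, b < a i & h i b = c]) [set c | c < g] ex.
- move=> i.
  have /choice[k kP] c : exists b, (exists2 b, b < a i & h i b = c) ->
      b < a i /\ h i b = c.
    case: (pselect (exists2 b, b < a i & h i b = c)) => [[b ? ?]|N].
      by exists b.
    by exists c => /N.
  exists k => [c /kP[]//|x y /kP[kx xE] /kP[ky yE] xy].
  rewrite ltNge -(increasing_below_le (hi i Logic.I) ky kx) xE yE -ltNge.
  exact: xy.
- move=> x xg; exists [set i | [set: I] i /\ exists2 b, b < a i & h i b <= x].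
    exact: hf.
  move=> y yg yx; have [i [b [_ bi yE]]] := ho y yg.
  exists i; last by exists b.
  by split=> //; exists b; rewrite // yE; case: yx => [->|/ltW].
- rewrite leNgt; apply/negP => lt_g; have := kg _ lt_g; rewrite ltNge.
  rewrite (@le_increasing g k) // => x y xy yg.
  by apply: km => //; exact: lt_trans yg.
Qed.

(** The enumeration built for the shuffle attains the infimum, since its sum is at most that of any
    other. *)
Lemma shuffle_big_sum (I : Type) (a : I -> ordinal_num) :
  countable [set: I] -> (forall i, ozero < a i) ->
  exists h, shuffle [set: I] a (big_natural_sum a) h /\
    locally_finite [set: I] a (big_natural_sum a) h.
Proof.
move=> cI a0; have [d [f [fb [h [hP hf]]]]] := countable_shuffle cI a0.
suff -> : big_natural_sum a = iter_natural_sum (fun c : below d => a (f c)).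
  by exists h.
apply/eqP; rewrite eq_le (@shuffle_le_big_sum _ _ _ h) //; last by exists d, f.
by rewrite andbT; apply: oinf_le; exists d, f.
Qed.

(** * Trees *)

Section Tree.
Variables (T : Type) (le : relation T) (tree : is_wf_tree le).
Hypothesis T_countable : countable [set: T].

Lemma tle_refl u : le u u.
Proof. by case: (tree_order tree). Qed.

Lemma tle_trans v u w : le u v -> le v w -> le u w.
Proof. by case: (tree_order tree) => _ tr _; exact: tr. Qed.

Lemma tle_anti u v : le u v -> le v u -> u = v.
Proof. by case: (tree_order tree) => _ _; exact. Qed.

Lemma tstrict_trans v u w : strict le u v -> strict le v w -> strict le u w.
Proof.
move=> [uv nuv] [vw nvw]; split=> [|uw]; first exact: tle_trans vw.
by apply: nvw; apply: tle_anti => //; rewrite -uw.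
Qed.

(** Climbing inside [P] must stop: a list of the finitely many elements above the current one
    shrinks at each step. *)
Lemma maximal_above (P : set T) u : P u ->
  exists m, [/\ P m, le u m & forall s, P s -> ~ strict le m s].
Proof.
have /(@finite_seqP {classic T})[s sE] := tree_up_finite tree u.
have {sE} : forall x, strict le u x -> x \in s.
  by move=> x ux; suff : [set` s] x by []; rewrite -sE.
have [n] := ubnP (size s); elim: n => // n IH in u s *.
rewrite ltnS => sn us Pu.
case: (pselect (exists2 v, P v & strict le u v)) => [[v Pv uv]|N]; last first.
  by exists u; split=> [//||v Pv uv]; [exact: tle_refl|apply: N; exists v].
have [||//|m [Pm vm mP]] := IH v [seq x <- s | x != (v : {classic T})].
- apply: leq_trans sn; rewrite size_filter -(count_predC (pred1 (v : {classic T})) s).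
  by rewrite -add1n leq_add // -has_count has_pred1 us.
- move=> x vx; rewrite (@mem_filter {classic T}) us ?andbT; last first.
    exact: tstrict_trans uv vx.
  by apply/eqP => xv; case: vx => _; apply.
- by exists m; split=> //; apply: tle_trans vm; case: uv.
Qed.

Lemma immediate_pred_above t u : strict le u t ->
  exists2 p, immediate_pred le t p & le u p.
Proof.
move=> /(@maximal_above [set s | strict le s t])[p [pt up pP]].
by exists p => //; split=> // -[s [ps st]]; exact: pP st ps.
Qed.

Lemma maximal_above_any u : exists2 p, maximal le p & le u p.
Proof.
have [p [_ up pP]] := @maximal_above setT u Logic.I.
by exists p => // -[s /pP]; exact.
Qed.

Lemma node_sizeE t : node_size tree t = osucc (big_natural_sum
  (fun u : {u | immediate_pred le t u} => node_size tree (sval u))).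
Proof.
rewrite {1}/node_size Fix_eq; first by rewrite oaddS oadd0.
move=> x f g fg; have -> // : f = g.
by apply: functional_extensionality_dep => y; exact/funext.
Qed.

Lemma node_size_gt0 t : ozero < node_size tree t.
Proof. by rewrite node_sizeE osuccP le0o. Qed.

(** * Forests below antichains *)

Definition antichain (C : set T) := forall p q, C p -> C q -> le p q -> p = q.

(** Treats alike the two places where sizes are summed: over the immediate predecessors of a node
    and over the maximal elements. *)
Definition forest (C : set T) : set T := [set u | exists2 p, C p & le u p].

Lemma antichain_pred t : antichain (immediate_pred le t).
Proof.
move=> p q [pt pP] [qt _] pq; apply: contrapT => ne.
by apply: pP; exists q.
Qed.

Lemma antichain_maximal : antichain (maximal le).
Proof. by move=> p q pP _ pq; apply: contrapT => ne; apply: pP; exists q. Qed.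

Lemma forest_pred t u : forest (immediate_pred le t) u <-> strict le u t.
Proof.
split=> [[p [pt _] up]|/immediate_pred_above[p]]; last by exists p.
case: (pselect (u = p)) => [->//|ne].
exact: (tstrict_trans _ pt).
Qed.

(** Two roots above [u] are comparable, because the elements above [u] are linearly ordered. *)
Lemma antichain_root_uniq C u p q : antichain C -> C p -> C q ->
  le u p -> le u q -> p = q.
Proof.
move=> aC Cp Cq up uq.
case: (pselect (u = p)) => [e|np]; first by apply: aC => //; rewrite -e.
case: (pselect (u = q)) => [e|nq]; first by apply/esym/aC => //; rewrite -e.
have [|] : le p q \/ le q p by apply: (@tree_up_linear _ _ tree u).
  exact: aC.
by move=> qp; apply/esym/aC.
Qed.

Lemma countable_sub (C : set T) : countable [set: {u | C u}].
Proof.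
have /countable_injP[f fI] := T_countable.
apply/countable_injP; exists (f \o sval) => -[x Cx] [y Cy] _ _ /= /fI.
by move=> e; apply: eq_exist; apply: e; rewrite inE.
Qed.

(** * The bound for an arbitrary downward-finite well-ordered extension *)

Section UpperBound.
Variable le' : relation T.
Hypotheses (wo : is_well_order le') (dfe : downward_finite_extension le le').

Let lt_tr x y z : strict le' x y -> strict le' y z -> strict le' x z.
Proof.
case: (wo_order wo) => _ tr an [xy nxy] [yz nyz]; split; first exact: tr yz.
by move=> xz; apply: nyz; apply: an => //; rewrite -xz.
Qed.

(** The points up to [v] in [le'] lie in the tree of [v] or in the trees of the elements [A]
    incomparable with [v]. The second hypothesis prevents such elements from lying above a root. *)
Lemma ranked_forest C (sz : T -> ordinal_num) :
  (forall p, ozero < sz p) ->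
  (forall p w v, C p -> strict le p w -> forest C v -> le v w) ->
  (forall p, C p -> ranked (strict le') (Defs.down le p) (sz p)) ->
  ranked (strict le') (forest C)
    (big_natural_sum (fun p : {p | C p} => sz (sval p))).
Proof.
move=> sz0 Ctop Csz.
apply: (ranked_big_sum lt_tr (X := fun p => Defs.down le (sval p))).
- have [d [f [fb _]]] :=
    countable_shuffle (countable_sub C) (fun p => sz0 (sval p)).
  by exists d, f.
- by move=> [p Cp]; exact: Csz.
- move=> v vC; case: dfe => _ _ /(_ v)[A [Af Av Ac]].
  have [p0 Cp0 vp0] := vC.
  have /choice[k kP] w : exists p : {p | C p}, forest C w -> le w (sval p).
    case: (pselect (forest C w)) => [[p Cp wp]|N].
      by exists (exist _ p Cp).
    by exists (exist _ p0 Cp0) => /N.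
  exists (k @` (v |` A)); first by apply: finite_image; rewrite finite_setU.
  move=> u uC uv.
  have /Ac[uv'|[w Aw uw]] : le' u v.
    by case: uv => [->|[]//]; case: (wo_order wo).
    by exists (k v); [exists v => //; left|apply: tle_trans uv' (kP _ vC)].
  exists (k w); first by exists w => //; right.
  (* It remains to see that [w] is in the forest. As [u] lies below both [w] and its root [p], these
     are comparable, and [w] strictly above [p] would be above [v]. *)
  apply: (tle_trans uw (kP _ _)); have [p Cp up] := uC.
  case: (pselect (u = p)) => [e|np]; last first.
    case: (pselect (u = w)) => [<-//|nw].
    have [wp|pw] : le w p \/ le p w by apply: (@tree_up_linear _ _ tree u).
      by exists p.
    case: (pselect (p = w)) => [<-|npw]; first by exists p => //; exact: tle_refl.
    by case: (Av w Aw) => _ []; apply: (Ctop p).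
  case: (pselect (u = w)) => [<-//|nw].
  by case: (Av w Aw) => _ []; apply: (Ctop p) => //; rewrite -e.
Qed.

Lemma ranked_node t : ranked (strict le') (Defs.down le t) (node_size tree t).
Proof.
elim/(well_founded_ind (tree_wf tree)): t => t IH.
have [|p [pt _]|g gb gm] :=
    @ranked_forest (immediate_pred le t) (node_size tree) node_size_gt0.
(* Both [w] and [t] are above [p], hence comparable; [w] strictly below [t] would contradict the
   immediacy of [p]. *)
- move=> p w v [pt pP] pw /forest_pred[vt _]; apply: tle_trans vt _.
  have [//|wt] := tree_up_linear tree pt pw.
  case: (pselect (w = t)) => [->|ne]; first exact: tle_refl.
  by case: pP; exists w.
- exact: IH.
rewrite node_sizeE; move: gb gm; set b := big_natural_sum _ => gb gm.
have [_ le_le' _] := dfe; have [_ _ an] := wo_order wo.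
have tP u : Defs.down le t u -> u <> t -> forest (immediate_pred le t) u.
  by move=> ut ne; apply/forest_pred.
(* The rank [b] is kept for [t], which comes last in its tree for [le'] too. *)
exists (fun u => if pselect (u = t) then b else g u) => [u ut|u v ut vt].
  by case: pselect => [/= _|/= ne]; rewrite osuccP // ltW // gb //; exact: tP.
move=> [uv ne]; case: pselect => [ut'|nut]; case: pselect => [vt'|nvt].
- by case: ne; rewrite ut' vt'.
- by case: nvt; apply: an; [exact: le_le'|rewrite -ut'].
- exact/gb/tP.
- by apply: gm => //; exact: tP.
Qed.

Lemma ranked_tree : ranked (strict le') setT (tree_size tree).
Proof.
apply: (@ranked_sub _ _ _ (forest (maximal le)) _ _ _ (lexx _)).
  by move=> u _; exact: maximal_above_any.
apply: ranked_forest => [|p w v pP pw|p _]; first exact: node_size_gt0.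
  by case: pP; exists w.
exact: ranked_node.
Qed.

End UpperBound.

(** * Construction of an extension of maximal type *)

(* A numbering of [S] by the ordinals below [a] along which the order of [T] is
   extended downward-finitely. *)
Record labelling (S : set T) a (g : T -> ordinal_num) : Prop := Labelling {
  label_lt : forall u, S u -> g u < a;
  label_onto : forall c, c < a -> exists2 u, S u & g u = c;
  label_inj : forall u v, S u -> S v -> g u = g v -> u = v;
  label_mono : forall u v, S u -> S v -> strict le u v -> g u < g v;
  label_finite : forall v, S v -> exists A : set T,
    [/\ finite_set A, forall w, A w -> incomparable le w v &
      forall u, S u -> g u <= g v -> le u v \/ exists2 w, A w & le u w] }.

(** The numberings of the trees are interleaved by a locally finite shuffle of the sizes, so only
    finitely many trees have begun by the label of a given point. *)
Lemma labelling_forest C (sz : T -> ordinal_num) :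
  antichain C -> (forall p, ozero < sz p) ->
  (forall p, C p -> exists g, labelling (Defs.down le p) (sz p) g) ->
  exists g, labelling (forest C)
    (big_natural_sum (fun p : {p | C p} => sz (sval p))) g.
Proof.
move=> aC sz0 Cl; pose I := {p | C p}.
have /choice[lab labP] (p : I) :
    exists g, labelling (Defs.down le (sval p)) (sz (sval p)) g.
  by case: p => p Cp; exact: Cl.
have [h [[hi hl ho hj] hf]] :=
  shuffle_big_sum (countable_sub C) (fun p : I => sz0 (sval p)).
set b := big_natural_sum _ in hl ho hf *.
(* A root is needed as default value for the choice of [k], so the empty forest is treated apart. *)
case: (pselect (exists p, C p)) => [[p0 Cp0]|N]; last first.
  exists (fun=> ozero).
  split=> [u|c|u v|u v|v]; try by case=> p Cp; case: N; exists p.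
  by move=> /ho[[p Cp]]; case: N; exists p.
have /choice[k kP] u : exists p : I, forest C u -> le u (sval p).
  case: (pselect (forest C u)) => [[p Cp up]|N]; last by exists (exist _ p0 Cp0).
  by exists (exist _ p Cp).
have k_uniq u (p : I) : le u (sval p) -> k u = p.
  case: p => p Cp /= up.
  have := kP u (ex_intro2 _ _ p Cp up); case: (k u) => q Cq /= uq.
  by apply: eq_exist; apply: antichain_root_uniq aC Cq Cp uq up.
have klt u : forest C u -> lab (k u) u < sz (sval (k u)).
  by move=> /kP; exact: label_lt (labP _) u.
have hle (p : I) x y : x < sz (sval p) -> y < sz (sval p) ->
    (h p x <= h p y) = (x <= y).
  by move=> xp yp; exact: (increasing_below_le (hi p Logic.I)).
exists (fun u => h (k u) (lab (k u) u)).
split=> [u uC|c /ho[p [x [_ xp <-]]]|u v uC vC e|u v uC vC uv|v vC].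
- by apply: hl => //; exact: klt.
- have [u up uE] := label_onto (labP p) xp.
  exists u; last by rewrite (k_uniq _ _ up) uE.
  by exists (sval p) => //; exact: (svalP p).
- have kk := hj _ _ _ _ Logic.I Logic.I (klt u uC) (klt v vC) e.
  have uv := klt u uC; have vv := klt v vC; have kv := kP v vC.
  rewrite -kk in vv kv e.
  apply: (label_inj (labP (k u))) => //; first exact: kP.
  by apply/eqP; rewrite eq_le -(hle _ _ _ uv vv) -(hle _ _ _ vv uv) e lexx.
- have uk : le u (sval (k v)) by apply: tle_trans (kP v vC); case: uv.
  have kuv := k_uniq _ _ uk; rewrite kuv.
  apply: hi => //; last exact: klt.
  exact: (label_mono (labP _) uk (kP v vC)).
- have [A [Af Av Ac]] := label_finite (labP (k v)) (kP v vC).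
  have hv := hl _ _ Logic.I (klt v vC).
  pose K := [set p : I | [set: I] p /\
    exists2 x, x < sz (sval p) & h p x <= h (k v) (lab (k v) v)].
  (* Inside the tree of [v] the given numbering provides [A]; every other tree already begun is
     covered by its root, which is incomparable with [v]. *)
  exists (A `|` (sval @` (K `&` [set p | p <> k v]))); split.
  + rewrite finite_setU; split=> //; apply: finite_image.
    exact: sub_finite_set (hf _ hv).
  + move=> w [/Av//|[p [_ /= nkv] <-]]; split=> [pv|vp].
      apply: nkv; have pk := tle_trans pv (kP v vC).
      by rewrite -(k_uniq _ _ pk); apply/esym/k_uniq; exact: tle_refl.
    by apply: nkv; rewrite (k_uniq v p).
  + move=> u uC uv; case: (pselect (k u = k v)) => [e|ne].
      have ukv : le u (sval (k v)) by rewrite -e; exact: kP.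
      have lu : lab (k v) u < sz (sval (k v)) by rewrite -e; exact: klt.
      move: uv; rewrite e hle //; last exact: klt.
      by case/(Ac u ukv)=> [|[w Aw uw]]; [left|right; exists w => //; left].
    right; exists (sval (k u)); last exact: kP.
    right; exists (k u) => //; split=> //; split=> //.
    by exists (lab (k u) u) => //; exact: klt.
Qed.

Lemma labelling_node t : exists g, labelling (Defs.down le t) (node_size tree t) g.
Proof.
elim/(well_founded_ind (tree_wf tree)): t => t IH.
have [|g] := labelling_forest (@antichain_pred t) node_size_gt0.
  by move=> p [pt _]; exact: IH.
rewrite node_sizeE; set b := big_natural_sum _ => -[gl go gi gm gf].
have tP u : Defs.down le t u -> u <> t -> forest (immediate_pred le t) u.
  by move=> ut ne; apply/forest_pred.
exists (fun u => if pselect (u = t) then b else g u).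
split=> [u ut|c|u v ut vt|u v ut vt [uv ne]|v vt].
- by case: pselect => [/= _|/= ne]; rewrite osuccP // ltW // gl //; exact: tP.
- rewrite osuccP le_eqVlt => /predU1P[->|/go[u /forest_pred[ut ne] <-]].
    by exists t; [exact: tle_refl|case: pselect].
  by exists u => //; case: pselect.
- case: pselect => [/= ->|/= nu]; case: pselect => [/= ->|/= nv] // e.
  + by have := gl v (tP v vt nv); rewrite -e ltxx.
  + by have := gl u (tP u ut nu); rewrite e ltxx.
  + by apply: gi e; exact: tP.
- case: pselect => [ut'|nu]; case: pselect => [vt'|nv].
  + by case: ne; rewrite ut' vt'.
  + by case: nv; apply: tle_anti => //; rewrite -ut'.
  + exact/gl/tP.
  + by apply: gm => //; exact: tP.
- case: pselect => [/= vt'|/= nv].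
    (* For the root [t], labelled last, the empty set suffices: its whole tree lies below it. *)
    by exists set0; split=> // u ut _; left; rewrite vt'.
  have [A [Af Av Ac]] := gf v (tP v vt nv); exists A; split=> // u ut.
  case: pselect => [/= _|/= nu]; last exact/Ac/tP.
  by rewrite leNgt gl //; exact: tP.
Qed.

Lemma labelling_tree : exists g, labelling setT (tree_size tree) g.
Proof.
have [g] := labelling_forest antichain_maximal node_size_gt0
  (fun p _ => labelling_node p).
suff -> : forest (maximal le) = setT by exists g.
by apply/seteqP; split=> u // _; exact: maximal_above_any.
Qed.

(** The order of the ordinals is pulled back along [g], whose values are exactly the ordinals below
    [a]. *)
Lemma labelling_extension g a : labelling setT a g ->
  exists (le' : relation T) (wo : is_well_order le'),
    downward_finite_extension le le' /\ otype (WellOrder wo) = a.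
Proof.
move=> [gl go gi gm gf]; pose le' : relation T := fun u v => g u <= g v.
have or : Relation_Definitions.order T le'.
  split=> [u|u v w|u v uv vu]; first exact: lexx.
    by rewrite /le'; exact: Order.le_trans.
  by apply: gi => //; apply/eqP; rewrite eq_le [_ <= _]uv.
have lt_g u v : strict le' u v -> g u < g v.
  move=> [uv ne]; rewrite lt_neqAle [_ <= _]uv andbT.
  by apply/eqP => e; apply: ne; exact: gi.
have wo : is_well_order le'.
  split=> [|u v|u]; [exact: or|by have /orP := le_total (g u) (g v)|].
  move: {2}(g u) (erefl (g u)) => b.
  elim/ord_ind: b u => b IH u e; constructor=> v /lt_g vu.
  by apply: (IH (g v)) => //; rewrite -e.
exists le', wo; split; last first.
  apply: (@otype_eq (WellOrder wo) g) => // c; split=> [/go[u _ <-]|[u <-]].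
    by exists u.
  exact: gl.
split=> // [u v uv|v].
  case: (pselect (u = v)) => [->|ne]; first exact: lexx.
  by apply/ltW/gm.
have [A [Af Av Ac]] := gf v Logic.I; exists A; split=> // u uv.
by case: (Ac u Logic.I uv) => [|[w Aw uw]]; [left|right; exists w].
Qed.

End Tree.

Theorem theorem6p3 (T : Type) (le : relation T) (tree : is_wf_tree le)
    (T_countable : countable [set: T]) :
  (exists (le' : relation T) (wo : is_well_order le'),
     downward_finite_extension le le' /\
     otype (WellOrder wo) = tree_size tree) /\
  (forall (le' : relation T) (wo : is_well_order le'),
     downward_finite_extension le le' ->
     ole (otype (WellOrder wo)) (tree_size tree)).
Proof.
split=> [|le' wo dfe].
  have [g gP] := labelling_tree tree T_countable.
  exact: (labelling_extension gP).
have [g gl gm] := ranked_tree tree T_countable wo dfe.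
by apply/oleP/(@otype_le (WellOrder wo) g) => [x y xy|x]; [exact: gm|exact: gl].
Qed.
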